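(* Let $F_t:\mathbb H\to\mathbb R$ be a weakly $A$-admissible nonlinearity, $h$-regularizing with $h>dr$ as in the definition of weak $A$-admissibility. Then there exists a forced time-periodic solution of regularity $h-d(r-1)-\tfrac12$, that is, $u:\mathbb R\to\mathbb H_{h-d(r-1)-1/2}\subset\mathbb H$ with $$\partial_tu=JAu+J\nabla F_t(u),\qquad u(t+T)=u(t).$$
   Context: Setting. $\mathbb H$ is a separable real Hilbert space (of functions of $x\in\mathbb R/X\mathbb Z$, $X>0$) with symplectic form $\omega$ and a complete orthonormal Darboux basis $e_n^\pm$, $n\in\mathbb Z\setminus\{0\}$: $\omega(e_i^+,e_j^-)=\delta_{ij}$, $Je_n^\pm=\mp e_n^\mp$, $\omega=\langle\cdot,J\cdot\rangle$. With $z_n=2^{-1/2}(e_n^++ie_n^-)$, $\mathbb H$ is identified with the complex Hilbert space with orthonormal basis $(z_n)$, with $J=i$; write $u=\sum_n\hat u(n)z_n$. Hilbert scale: $|u|_h^2=\sum_n|n|^{2h}|\hat u(n)|^2$, and for $h\in\mathbb R$, $\mathbb H_h$ is the space of (formal) series with $|u|_h<\infty$; $\mathbb H_0=\mathbb H$; $\langle\cdot,\cdot\rangle$ extends to a pairing of $\mathbb H_h$ and $\mathbb H_{-h}$. Admissible $A$: a densely defined self-adjoint operator with $Ae_n^\pm=\lambda_ne_n^\pm$, $\lambda_n=an^d$, $d\ge1$ an integer (the order of $A$), $a=(2\pi/X)^d$. Free flow: $\phi_t^A=e^{tJA}$, i.e. $\phi_t^Az_n=e^{itan^d}z_n$. The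 pair $(T,X)\in\mathbb R_{>0}^2$ is admissible if $aT/2\pi$ is Diophantine, i.e. has finite irrationality measure $r$; the irrationality measure of an irrational $\sigma$ is the infimum of all $\rho$ for which there is $c>0$ with $|\sigma-p/q|>c\,q^{-\rho}$ for all $p/q\in\mathbb Q$. Nonlinearities are time-dependent functions $F_t:\mathbb H\to\mathbb R$, always assumed smooth in $t$. $F_t$ is $h$-regularizing if it extends to a smooth map $\mathbb H_{-h}\to\mathbb R$. $F_t$ is weakly $A$-admissible if $A$ is admissible and there is a $t$-dependent $c_t=c_{t+T}\in\mathbb H_h$ such that $\bar F_t(u):=F_t(u)-\langle c_t,u\rangle$ satisfies: (1) $\bar F_{t+T}=\bar F_t$ with $(T,X)$ admissible; (2) $\bar F_t$ is $h$-regularizing with $h>dr$, $r$ the irrationality measure of $aT/2\pi$; (3) the extended map $\bar F_t:\mathbb H_{-h}\to\mathbb R$ has bounded $C^\alpha$-norms for all $\alpha\in\mathbb N$ (uniformly in $t$). The solution is understood in the weak sense: $u(t)=\phi_t^Av(t)$ with $v$ differentiable in $\mathbb H$ and $\dot v=J\nabla G_t(v)$, where $G_t=F_t\circ\phi_t^A$. *)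

(* Defs.v *)
From HB Require Import structures.
From mathcomp Require Import all_boot all_order all_algebra.
From mathcomp Require Import all_classical all_reals all_analysis.
From mathcomp Require Import complex ring lra.

Set Implicit Arguments.
Unset Strict Implicit.
Unset Printing Implicit Defensive.

Import Order.TTheory GRing.Theory Num.Theory.
Import numFieldNormedType.Exports.

Local Open Scope classical_set_scope.
Local Open Scope ring_scope.

Definition nzint := {n : int | n != 0}.

(** * The Hilbert scale

  A (formal) series [u = \sum_n u^(n) z_n] is represented by its coefficient
  function [nzint -> Rcomplex R], where [Rcomplex R] is R[i] seen as a real
  vector space.  A real vector [\sum_n p_n e_n^+ + q_n e_n^-] has coefficients
  [u^(n) = p_n - i q_n]: then [J e_n^+ = - e_n^-] and [J e_n^- = e_n^+] become
  multiplication by [i], and the real inner product for which the [e_n^+], [e_n^-]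
  are orthonormal is the real part of the Hermitian one. *)

Section HilbertScale.
Variable R : realType.
Implicit Types (s : R) (f g : nzint -> Rcomplex R).

Definition hweight s (n : nzint) : R := `|val n|%N%:R `^ (2 * s).

Definition hsqnorm s f : \bar R :=
  (\esum_(n in [set: nzint]) (hweight s n * `|f n| ^+ 2)%:E)%E.

Definition in_hscale s : {pred nzint -> Rcomplex R} :=
  fun f => (hsqnorm s f < +oo)%E.

Lemma hweight_gt0 s n : 0 < hweight s n.
Proof.
by apply: powR_gt0; rewrite ltr0n absz_gt0; exact: valP n.
Qed.

Let hterm_ge0 s f n : 0 <= hweight s n * `|f n| ^+ 2.
Proof. by rewrite mulr_ge0 ?exprn_ge0 // ltW // hweight_gt0. Qed.

Lemma hsqnorm_ge0 s f : (0 <= hsqnorm s f)%E.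
Proof. by apply: esum_ge0 => n _; rewrite lee_fin. Qed.

Lemma hsqnorm_le s f (M : R) :
  (forall r : seq nzint, uniq r -> \sum_(n <- r) hweight s n * `|f n| ^+ 2 <= M) ->
  (hsqnorm s f <= M%:E)%E.
Proof.
move=> HM; apply: ge_ereal_sup => _ [A [finA _] <-].
by rewrite fsbig_finite //= sumEFin lee_fin; apply: HM; exact: finmap.fset_uniq.
Qed.

Lemma hsqnorm_ge s f (r : seq nzint) : uniq r -> in_hscale s f ->
  \sum_(n <- r) hweight s n * `|f n| ^+ 2 <= fine (hsqnorm s f).
Proof.
move=> ur fs; rewrite -lee_fin fineK; last first.
  by rewrite ge0_fin_numE ?hsqnorm_ge0.
apply: esum_ge; exists [set` r]; first by split => //; exact: finite_seq.
rewrite fsbig_finite ?finite_seq //= sumEFin lee_fin.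
rewrite (perm_big (finmap.enum_fset (fset_set [set` r]))) //=.
rewrite uniq_perm ?finmap.fset_uniq // => n.
by apply/idP/idP; rewrite in_fset_set ?finite_seq //= in_setE.
Qed.

Let le_sqrt_add (p q P Q : R) : 0 <= p -> 0 <= q -> 0 <= P -> 0 <= Q ->
  (p + q) ^+ 2 + (Num.sqrt P + Num.sqrt Q) ^+ 2 <=
  (Num.sqrt (p ^+ 2 + P) + Num.sqrt (q ^+ 2 + Q)) ^+ 2.
Proof.
move=> p0 q0 P0 Q0.
rewrite -{2}(sqr_sqrtr P0) -{2}(sqr_sqrtr Q0).
have := sqrtr_ge0 Q; have := sqrtr_ge0 P.
move: (Num.sqrt P) (Num.sqrt Q) => x y x0 y0.
have H : p * q + x * y <=
    Num.sqrt (p ^+ 2 + x ^+ 2) * Num.sqrt (q ^+ 2 + y ^+ 2).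
  rewrite -sqrtrM ?addr_ge0 ?sqr_ge0 //.
  rewrite -[leLHS]ger0_norm ?addr_ge0 ?mulr_ge0 // -sqrtr_sqr ler_wsqrtr //.
  by have := sqr_ge0 (p * y - q * x); nra.
rewrite [leRHS]sqrrD !sqr_sqrtr ?addr_ge0 ?sqr_ge0 //; nra.
Qed.

Let minkowski_seq s f g (r : seq nzint) :
  \sum_(n <- r) hweight s n * `|f n + g n| ^+ 2 <=
  (Num.sqrt (\sum_(n <- r) hweight s n * `|f n| ^+ 2) +
   Num.sqrt (\sum_(n <- r) hweight s n * `|g n| ^+ 2)) ^+ 2.
Proof.
elim: r => [|n r IH]; first by rewrite !big_nil sqr_ge0.
rewrite !big_cons.
have w0 : 0 <= hweight s n by rewrite ltW // hweight_gt0.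
have E (z : R) : hweight s n * z ^+ 2 = (Num.sqrt (hweight s n) * z) ^+ 2.
  by rewrite exprMn sqr_sqrtr.
apply: le_trans (lerD (lexx _) IH) _; rewrite !E.
apply: le_trans (le_sqrt_add _ _ _ _); try by rewrite ?mulr_ge0 ?sqrtr_ge0.
- rewrite lerD2r -mulrDr ler_pXn2r ?nnegrE ?mulr_ge0 ?addr_ge0 ?sqrtr_ge0 //.
  by rewrite ler_wpM2l ?sqrtr_ge0 // ler_normD.
- by apply: sumr_ge0.
- by apply: sumr_ge0.
Qed.

Let hsqnormD_le s f g : in_hscale s f -> in_hscale s g ->
  (hsqnorm s (f + g)%R <= ((Num.sqrt (fine (hsqnorm s f)) +
     Num.sqrt (fine (hsqnorm s g))) ^+ 2)%:E)%E.
Proof.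
move=> fs gs; apply: hsqnorm_le => r ur; apply: le_trans (minkowski_seq _ _ _ _) _.
rewrite ler_pXn2r ?nnegrE ?addr_ge0 ?sqrtr_ge0 //.
by rewrite lerD // ler_wsqrtr // hsqnorm_ge.
Qed.

Let normcZ (a : R) (z : Rcomplex R) : `|a *: z| = `|a| * `|z|.
Proof.
case: z => x y; rewrite /Num.norm /= !exprMn -mulrDr sqrtrM ?sqr_ge0 //.
by rewrite sqrtr_sqr.
Qed.

Let hsqnormZ_le s (a : R) f : in_hscale s f ->
  (hsqnorm s (a *: f)%R <= (a ^+ 2 * fine (hsqnorm s f))%:E)%E.
Proof.
move=> fs; apply: hsqnorm_le => r ur.
have -> : \sum_(n <- r) hweight s n * `|(a *: f) n| ^+ 2 =
    a ^+ 2 * \sum_(n <- r) hweight s n * `|f n| ^+ 2.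
  rewrite big_distrr /=; apply: eq_bigr => n _.
  by rewrite normcZ exprMn real_normK ?num_real // mulrCA.
by rewrite ler_wpM2l ?sqr_ge0 // hsqnorm_ge.
Qed.

Lemma in_hscale_submod s : submod_closed (in_hscale s).
Proof.
split=> [|a f g fs gs]; rewrite ?unfold_in.
  apply: (@le_lt_trans _ _ 0%:E); last exact: ltry.
  apply: hsqnorm_le => r _; rewrite big1 // => n _.
  by rewrite normr0 expr0n mulr0.
have afs : in_hscale s (a *: f).
  by apply: le_lt_trans (hsqnormZ_le _ fs) _; exact: ltry.
by apply: le_lt_trans (hsqnormD_le afs gs) _; exact: ltry.
Qed.

HB.instance Definition _ s :=
  GRing.isSubmodClosed.Build R (nzint -> Rcomplex R) (in_hscale s)
    (in_hscale_submod s).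

(** [hscale s] is the space H_s. *)
Record hscale s := HScale {
  coef :> nzint -> Rcomplex R;
  coefP : coef \in in_hscale s
}.

HB.instance Definition _ s := [isSub for @coef s].
HB.instance Definition _ s := [Choice of hscale s by <:].
HB.instance Definition _ s := [SubChoice_isSubLmodule of hscale s by <:].

Definition hnorm s (u : hscale s) : R := Num.sqrt (fine (hsqnorm s u)).

Let hnormD s (u v : hscale s) : hnorm (u + v) <= hnorm u + hnorm v.
Proof.
rewrite -[leRHS]ger0_norm ?addr_ge0 ?sqrtr_ge0 // -sqrtr_sqr ler_wsqrtr //.
rewrite -lee_fin fineK; first exact: hsqnormD_le (coefP u) (coefP v).
by rewrite ge0_fin_numE ?hsqnorm_ge0 //; exact: (coefP (u + v)).
Qed.

Let hnormZ_le s (a : R) (u : hscale s) : hnorm (a *: u) <= `|a| * hnorm u.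
Proof.
rewrite -sqrtr_sqr -sqrtrM ?sqr_ge0 // ler_wsqrtr // -lee_fin fineK.
  exact: hsqnormZ_le (coefP u).
by rewrite ge0_fin_numE ?hsqnorm_ge0 //; exact: (coefP (a *: u)).
Qed.

Let hnorm0 s : hnorm (0 : hscale s) = 0.
Proof.
apply/eqP; rewrite eq_le sqrtr_ge0 andbT.
by have := hnormZ_le 0 (0 : hscale s); rewrite scale0r normr0 mul0r.
Qed.

Let hnormZ s (a : R) (u : hscale s) : hnorm (a *: u) = `|a| * hnorm u.
Proof.
have [->|a0] := eqVneq a 0; first by rewrite scale0r hnorm0 normr0 mul0r.
apply/eqP; rewrite eq_le hnormZ_le /= mulrC -ler_pdivlMr ?normr_gt0 //.
have := hnormZ_le a^-1 (a *: u).
by rewrite scalerA mulVf // scale1r normfV mulrC.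
Qed.

Let hnorm_eq0 s (u : hscale s) : hnorm u = 0 -> u = 0.
Proof.
move=> /eqP; rewrite sqrtr_eq0 => u0; apply/val_inj/funext => n /=.
have := hsqnorm_ge (r := [:: n]) isT (coefP u).
rewrite big_seq1 => /le_trans/(_ u0); rewrite pmulr_rle0 ?hweight_gt0 //.
by move=> H; apply/eqP; rewrite -normr_eq0 -sqrf_eq0 eq_le H sqr_ge0.
Qed.

HB.instance Definition _ s := Lmodule_isNormed.Build R (hscale s)
  (@hnormD s) (@hnormZ s) (@hnorm_eq0 s).

(** Unconditional sum of a real family; junk unless absolutely summable. *)
Definition rsum (I : choiceType) (x : I -> R) : R :=
  fine (\esum_(i in [set: I]) ((EFin \o x)^\+ i)%E
      - \esum_(i in [set: I]) ((EFin \o x)^\- i)%E)%E.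

(** The real inner product of H_0, and its extension to H_s x H_{-s}. *)
Definition pairing f g : R :=
  rsum (fun n => complex.Re (f n * (conjc (g n) : Rcomplex R))).

Let in_hscale_rot s (m : nzint -> Rcomplex R) (u : hscale s) :
  (forall n, `|m n| = 1) -> (fun n => m n * u n) \in in_hscale s.
Proof.
move=> m1.
suff E : hsqnorm s (fun n => m n * u n) = hsqnorm s u.
  by rewrite unfold_in /in_hscale E; exact: coefP u.
apply: eq_esum => n _; congr (_ * _ ^+ 2)%:E.
by rewrite -[RHS]mul1r -(m1 n); exact: Normc.normcM.
Qed.

Definition rot s (m : nzint -> Rcomplex R) (m1 : forall n, `|m n| = 1)
  (u : hscale s) : hscale s := HScale (in_hscale_rot u m1).

Let norm_i (n : nzint) : `|('i%C : Rcomplex R)| = 1.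
Proof. by rewrite /Num.norm /= expr0n expr1n add0r sqrtr1. Qed.

Definition J s : hscale s -> hscale s := rot norm_i.

Definition cis (x : R) : Rcomplex R := Complex (cos x) (sin x).

Let norm_cis x : `|cis x| = 1.
Proof. by rewrite /Num.norm /= cos2Dsin2 sqrtr1. Qed.

Definition freq (d : nat) (X : R) : R := (2 * pi / X) ^+ d.

(** Eigenvalue [a n^d] of the admissible operator A of order d. *)
Definition eigenA (d : nat) (X : R) (n : nzint) : R :=
  freq d X * (val n)%:~R ^+ d.

(** The free flow [exp (t J A)]. *)
Definition flowA s (d : nat) (X t : R) : hscale s -> hscale s :=
  rot (fun n => norm_cis (t * eigenA d X n)).

End HilbertScale.

Arguments flowA {R s}.

(** * Diophantine condition *)

Section Diophantine.
Variable R : realType.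

Definition irr_exponents (x : R) : set R :=
  [set rho | exists2 c : R, 0 < c &
     forall (p : int) (q : nat), (0 < q)%N ->
       c * q%:R `^ (- rho) < `|x - p%:~R / q%:R| ].

(** Only meaningful for diophantine x; [inf] is 0 on the empty set. *)
Definition irr_measure (x : R) : R := inf (irr_exponents x).

Definition diophantine (x : R) : Prop :=
  irrational x /\ irr_exponents x !=set0.

Definition rotnum (d : nat) (T X : R) : R := freq d X * T / (2 * pi).

Definition admissible_pair (d : nat) (T X : R) : Prop :=
  [/\ 0 < T, 0 < X & diophantine (rotnum d T X)].

End Diophantine.

(** * Smoothness *)

Section Smoothness.
Variables (R : realType) (V : normedModType R).

Definition smooth_curve (c : R -> V) : Prop :=
  forall (k : nat) (t : R), derivable (derive1n k c) t 1.

(** [D] gives the iterated Frechet derivatives of [f]: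
    [D u [:: w1; ..; wk]] is [D^k f(u)[w1, .., wk]]. The conditions say that
    each [D^k f(u)] is a bounded k-linear form and that [D^(k+1) f] is the
    Frechet derivative of [D^k f] for the operator norm on k-linear forms;
    they determine [D]. *)
Record iter_derivatives (f : V -> R) (D : V -> seq V -> R) : Prop := {
  iterd0 : forall u, D u [::] = f u;
  iterd_linear : forall u s1 s2 a w w',
    D u (s1 ++ (a *: w + w') :: s2) =
      a * D u (s1 ++ w :: s2) + D u (s1 ++ w' :: s2);
  iterd_bounded : forall u k, exists C : R, forall ws, size ws = k ->
    `|D u ws| <= C * \prod_(w <- ws) `|w|;
  iterdS : forall u k (eps : R), 0 < eps -> \forall w \near (0 : V),
    forall ws, size ws = k ->
      `|D (u + w) ws - D u ws - D u (w :: ws)| <=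
        eps * `|w| * \prod_(x <- ws) `|x|
}.

Definition smooth (f : V -> R) : Prop := exists D, iter_derivatives f D.

(** [C] bounds the C^alpha-norm of [f]. *)
Definition Calpha_bound (alpha : nat) (f : V -> R) (C : R) : Prop :=
  forall D, iter_derivatives f D -> forall u ws, (size ws <= alpha)%N ->
    `|D u ws| <= C * \prod_(w <- ws) `|w|.

End Smoothness.

(** * Nonlinearities and solutions *)

Section Nonlinearity.
Variable R : realType.

Definition Fbar (h : R) (F : R -> hscale (0 : R) -> R) (c : R -> hscale h)
  (t : R) (u : hscale (0 : R)) : R := F t u - pairing (c t) u.

(** [Fe] is the extension to H_{-h} of [f], which is defined on H. *)
Definition extends_to (h : R) (f : hscale (0 : R) -> R)
    (fe : hscale (- h) -> R) : Prop :=
  forall (u : hscale (0 : R)) (w : hscale (- h)), u =1 w -> fe w = f u.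

(** Pointwise in u, the weakest reading of "F_t is smooth in t". *)
Definition smooth_in_time (F : R -> hscale (0 : R) -> R) : Prop :=
  forall u, smooth_curve (fun t => F t u : R^o).

Definition weakly_admissible (d : nat) (T X h : R)
    (F : R -> hscale (0 : R) -> R) : Prop :=
  [/\ (0 < d)%N, admissible_pair d T X,
      d%:R * irr_measure (rotnum d T X) < h, smooth_in_time F &
      exists c : R -> hscale h,
        [/\ smooth_curve c, forall t, c (t + T) = c t,
            forall t, Fbar F c (t + T) =1 Fbar F c t &
            exists Fe : R -> hscale (- h) -> R,
              [/\ forall t, extends_to (Fbar F c t) (Fe t),
                  forall t, smooth (Fe t) &
                  forall alpha, exists C, forall t,
                    Calpha_bound alpha (Fe t) C]]].

Definition is_gradient (f : hscale (0 : R) -> R) (u g : hscale (0 : R)) : Prop :=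
  is_diff u (f : hscale (0 : R) -> R^o) (fun w => pairing g w : R^o).

(** [v' = J grad G_t (v)] with [G_t = F_t \o flowA t]; then [flowA t (v t)] is
    a weak solution of [u' = J A u + J grad F_t (u)]. *)
Definition interaction_solution (d : nat) (X : R)
    (F : R -> hscale (0 : R) -> R) (v : R -> hscale (0 : R)) : Prop :=
  forall t, exists2 g, is_gradient (F t \o flowA d X t) (v t) g &
    is_derive t 1 v (J g).

Definition weak_solution (d : nat) (X : R)
    (F : R -> hscale (0 : R) -> R) (u : R -> hscale (0 : R)) : Prop :=
  exists2 v, interaction_solution d X F v & forall t, u t = flowA d X t (v t).

End Nonlinearity.

(* Main.v *)
(** In the rotating frame [u = flowA t v] the unbounded operator disappears, and the
  forced T-periodic solutions correspond to the solutions of [v' = J g(t, v)],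
  [g = grad G_t], with [v (t + T) = flowA (- T) (v t)].  The hypotheses make [g]
  bounded in H_h and Lipschitz.  Solving the boundary condition for [v 0] divides
  the n-th coefficient by [exp (- i T a n^d) - 1], which is at least
  [c |n|^(- d (rho - 1))] for an exponent [rho] slightly larger than the
  irrationality measure.  So the map that closes up an Euler polygon has bounded
  range in H_s, [s = h - d (rho - 1) > 0], which is compactly embedded in H, and
  Schauder's theorem yields closed Euler polygons for every step size.  They are
  bounded in H_s and equicontinuous; their limit along an ultrafilter is the
  solution, since the difference estimates pass to the limit pointwise in time.

  Brouwer's theorem comes from a mod 2 degree.  For 0/1-labels a_1, .., a_n on a
  periodic grid, the sum of the cup product da_1 .. da_n over all Kuhn simplices
  depends only on the periods of the da_i by Stokes' theorem, and it is 1 when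
  these are the standard ones; so some simplex carries both values of every
  label. *)

Require Import Defs.
From HB Require Import structures.
From mathcomp Require Import all_boot all_order all_algebra all_fingroup.
From mathcomp Require Import all_classical all_reals all_analysis.
From mathcomp Require Import complex zify ring lra.

Set Implicit Arguments.
Unset Strict Implicit.
Unset Printing Implicit Defensive.

(** * Brouwer's fixed point theorem *)

(** No smallness is assumed, so the closing equation is out of reach of a contraction; only bounds
    are uniform. The compactness is what remains of the smoothing: the gradient lies in H_h and the
    small divisors cost d (rho - 1). The infimum r of the exponents need not be attained; rho < r +
    1/(2d) is chosen, and d (rho - r) < 1/2 is the loss of 1/2 in the final regularity. Time is
    discretized so that no vector-valued integral occurs: the drift over a period is a finite sum in
    H_h, on which the inverse of exp(-TJA) - 1 acts. In the limit one ultrafilter fixes the values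
    at all real times at once, in place of Arzela-Ascoli. For the nonlinear part, regularity and
    periodicity in t are given only for values at fixed points of H. The gradient inherits them
    through difference quotients, controlled uniformly by the second derivatives. *)

Section Cup.
Variable V : Type.
Implicit Types (f b : V -> bool) (fs : seq (V -> bool)) (s : seq V).

(* With F_2 = (bool, addb, andb), the cup product of the coboundaries of the
   0-cochains [fs], evaluated on the simplex with vertices [s]. *)
Fixpoint cup fs s : bool :=
  match fs, s with
  | f :: fs', x :: ((y :: _) as s') => (f x (+) f y) && cup fs' s'
  | _, _ => true
  end.

(* The same with the 0-cochain [b] itself inserted at position [i]. *)
Fixpoint mcup i b fs s : bool :=
  match i, fs, s with
  | 0, _, x :: _ => b x && cup fs s
  | i'.+1, f :: fs', x :: ((y :: _) as s') => (f x (+) f y) && mcup i' b fs' s'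
  | _, _, _ => true
  end.

Definition omit k s := take k s ++ drop k.+1 s.

(** A product of coboundaries is closed. The two faces omitting one of the first two vertices
    contribute [f x (+) f y] times the product on the tail; by induction the remaining faces
    contribute the same. *)
Lemma cup_faces fs s : size s = (size fs).+2 ->
  \big[addb/false]_(k < size s) cup fs (omit k s) = false.
Proof.
elim: fs s => [|f fs IH] [|x [|y s]] //=.
  by case: s => // _; rewrite !big_ord_recl big_ord0.
case: s => [//|z s] [ss].
rewrite big_ord_recl /= big_ord_recl /=.
have := IH [:: y, z & s]; rewrite /= ss big_ord_recl /= => /(_ erefl).
rewrite /omit /=.
under [X in _ -> _ (+) (_ (+) X) = _]eq_bigr do rewrite /=.
rewrite -big_distrr /=.
set S := \big[addb/false]_(i < _) _; move: S (cup fs (z :: s)) => S A.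
by case: (f x) (f y) (f z) A S => [] [] [] [] [].
Qed.

(* The Leibniz rule; only the slot of [b] contributes, as the others are closed. *)
Lemma mcup_faces i b fs s : size s = (size fs).+2 -> i <= size fs ->
  \big[addb/false]_(k < size s) mcup i b fs (omit k s) =
  cup (take i fs ++ b :: drop i fs) s.
Proof.
elim: i fs s => [|i IH] fs [|x [|y s]] //= ss.
  have := @cup_faces fs [:: x, y & s] ss.
  rewrite take0 drop0 !big_ord_recl /omit /=.
  rewrite -!big_distrr /=.
  set S := \big[addb/false]_(i < _) _; move: S (cup fs (x :: _)) (cup fs _) => S A B.
  by case: (b x) (b y) A B S => [] [] [] [] [].
case: fs ss => [//|f fs] /= [ss] ifs; case: s ss => [//|z s] [ss].
have := IH fs [:: y, z & s]; rewrite /= ss => /(_ erefl ifs).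
rewrite big_ord_recl /omit /= => <-.
rewrite !big_ord_recl /= -!big_distrr /=.
set S := \big[addb/false]_(i < _) _; move: S (mcup _ _ _ _) => S A.
by case: (f x) (f y) (f z) A S => [] [] [] [] [].
Qed.

Lemma cupP f0 x0 fs s : size s = (size fs).+1 -> cup fs s ->
  forall i, i < size fs ->
    nth f0 fs i (nth x0 s i) (+) nth f0 fs i (nth x0 s i.+1).
Proof.
elim: fs s => [|f fs IH] [|x [|y s]] //= [ss] /andP[fxy cs] [|i] //=.
by rewrite ltnS; apply: (IH (y :: s)); rewrite //= ss.
Qed.

Lemma cupT x0 f0 fs s : size s = (size fs).+1 ->
  (forall i, i < size fs ->
    nth f0 fs i (nth x0 s i) (+) nth f0 fs i (nth x0 s i.+1)) -> cup fs s.
Proof.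
elim: fs s => [|f fs IH] [|x [|y s]] //= [ss] H; rewrite (H 0) //=.
by apply: (IH (y :: s)); rewrite /= ?ss // => i; apply: (H i.+1).
Qed.

Lemma cup_add f g h fs1 fs2 s : (forall x, h x = f x (+) g x) ->
  size s = (size fs1 + size fs2).+2 ->
  cup (fs1 ++ h :: fs2) s = cup (fs1 ++ f :: fs2) s (+) cup (fs1 ++ g :: fs2) s.
Proof.
move=> hE; elim: fs1 s => [|k fs1 IH] [|x [|y s]] //= [ss].
  rewrite !hE; move: (cup _ _) => A.
  by case: (f x) (f y) (g x) (g y) A => [] [] [] [] [].
case: s ss => [//|z s] [ss]; rewrite IH ?andb_addr //= ss //.
Qed.

(** Only differences of the labels enter. The map will be a translation by a full period, which may
    flip the labels themselves. *)
Lemma cup_map fs s (g : V -> V) :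
  (forall k, k < size fs -> forall x y,
    nth xpred0 fs k (g x) (+) nth xpred0 fs k (g y) =
    nth xpred0 fs k x (+) nth xpred0 fs k y) ->
  cup fs (map g s) = cup fs s.
Proof.
elim: fs s => [|f fs IH] [|x [|y s]] //= H; rewrite (H 0) //; congr (_ && _).
by apply: (IH (y :: s)) => k; apply: (H k.+1).
Qed.

Lemma mcup_map i b fs s (g : V -> V) : (forall x, b (g x) = b x) ->
  (forall k, k < size fs -> forall x y,
    nth xpred0 fs k (g x) (+) nth xpred0 fs k (g y) =
    nth xpred0 fs k x (+) nth xpred0 fs k y) ->
  mcup i b fs (map g s) = mcup i b fs s.
Proof.
move=> bg; elim: i fs s => [|i IH] fs [|x s] H.
- by case: fs {H}.
- by rewrite /= bg -(cup_map (x :: s) H); case: fs {H}.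
- by case: fs {H}.
case: fs H => [//|f fs] H; case: s => [//|y s] /=; rewrite (H 0) //.
by congr (_ && _); apply: (IH fs (y :: s)) => k; apply: (H k.+1).
Qed.

End Cup.

(** * Mod 2 cochains on Kuhn's triangulation of a torus *)

Section Kuhn.
Variables n' p : nat.
Let n := n'.+1.
Local Notation V := ('I_n -> nat).
Implicit Types (x y : V) (s : 'S_n) (q : {ffun 'I_n -> 'I_p.+1}).

(* The simplex of Kuhn's triangulation of the cube at [x] that increases
   coordinate [c] at step [s c]. *)
Definition vertex x s (k : nat) : V := fun c => x c + (s c < k).

Definition chain x s : seq V := [seq vertex x s k | k <- iota 0 n.+1].

Definition translate (c : 'I_n) (m : nat) x : V := fun j => x j + (j == c) * m.

Definition covariant (f : V -> bool) := forall c x y,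
  f (translate c p.+1 x) (+) f (translate c p.+1 y) = f x (+) f y.

Lemma omit_chain k x s : omit k (chain x s) =
  [seq vertex x s l | l <- omit k (iota 0 n.+1)].
Proof. by rewrite /omit /chain map_cat map_take map_drop. Qed.

Lemma omit_iota k m : k < m ->
  omit k (iota 0 m) = iota 0 k ++ iota k.+1 (m - k.+1).
Proof. by move=> /ltnW km; rewrite /omit take_iota drop_iota (minn_idPl km). Qed.

(** Exchanging the steps [k] and [k.+1] moves only the vertex between them, which is the omitted
    one. *)
Lemma omit_chain_tperm k x s (i j : 'I_n) : i = k :> nat -> j = k.+1 :> nat ->
  omit k.+1 (chain x (s * tperm i j)%g) = omit k.+1 (chain x s).
Proof.
move=> ik jk; rewrite !omit_chain omit_iota; last by rewrite ltnS -jk ltnW.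
apply/eq_in_map => l; rewrite mem_cat !mem_iota => lk; apply/funext => c.
rewrite /vertex permM; congr (_ + nat_of_bool _).
have lk' : l != k.+1 by lia.
by case: tpermP => [->|->|//]; rewrite ?ik ?jk; lia.
Qed.

Definition rot_perm : 'S_n := perm (@ord_pred_inj n).

(** The cube moves one unit along the coordinate that [s] raises first, and [rot_perm] turns this
    first step into the last one. *)
Lemma omit0_chain x s :
  omit 0 (chain x s) = omit n (chain (translate ((s^-1)%g ord0) 1 x) (s * rot_perm)%g).
Proof.
rewrite !omit_chain !omit_iota // subnn cats0 cat0s.
have -> : iota 1 (n.+1 - 1) = map (addn 1) (iota 0 n) by rewrite subn1 -iotaDl.
rewrite -map_comp.
apply/eq_in_map => l; rewrite mem_iota /= add0n => ln; apply/funext => c.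
rewrite /vertex /translate permM [rot_perm _]permE /= muln1 -addnA; congr (_ + _).
rewrite -(canF_eq (permK s)) -val_eqE /=.
case: (posnP (s c)) => [->|sc0]; first by rewrite /= modn_small; lia.
rewrite (_ : (s c + n).-1 = (s c).-1 + n) ?modnDr; last by rewrite -subn1 -addnBAC // subn1.
by rewrite modn_small; have := ltn_ord (s c); lia.
Qed.

Lemma translate_chain c m x s : chain (translate c m x) s = map (translate c m) (chain x s).
Proof.
rewrite /chain -map_comp; apply: eq_map => l; apply/funext => j.
by rewrite /vertex /translate /= addnAC.
Qed.

Lemma map_omit (A B : Type) (g : A -> B) k (l : seq A) :
  omit k (map g l) = map g (omit k l).
Proof. by rewrite /omit map_cat map_take map_drop. Qed.

Definition corner q : V := fun c => q c.

Lemma sum_translate (B : V -> bool) c : (forall x, B (translate c p.+1 x) = B x) ->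
  \big[addb/false]_q B (translate c 1 (corner q)) = \big[addb/false]_q B (corner q).
Proof.
move=> Bper.
pose h q := [ffun j => if j == c then ordS (q j) else q j] : {ffun 'I_n -> 'I_p.+1}.
have hi : injective h.
  move=> q1 q2 /ffunP qq; apply/ffunP => j; have := qq j; rewrite !ffunE.
  by case: eqP => // _ /ordS_inj.
rewrite [RHS](reindex_inj hi); apply: eq_bigr => q _.
have [qc|qc] := ltnP (q c) p.
  congr B; apply/funext => j; rewrite /translate /corner ffunE.
  case: eqP => [->|_] /=; last by rewrite addn0.
  by rewrite modn_small ?muln1 ?addn1.
rewrite -[RHS]Bper; congr B; apply/funext => j; rewrite /translate /corner ffunE.
case: eqP => [->|_] /=; last by rewrite addn0.
have -> : nat_of_ord (q c) = p by apply/eqP; rewrite eqn_leq qc -ltnS ltn_ord.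
by rewrite modnn muln1 mul1n addn1.
Qed.

Definition csum (fs : seq (V -> bool)) :=
  \big[addb/false]_q \big[addb/false]_s cup fs (chain (corner q) s).

Lemma size_chain x s : size (chain x s) = n.+1.
Proof. by rewrite size_map size_iota. Qed.

Lemma sum_invol (f : 'S_n -> bool) (t : 'S_n) : odd_perm t ->
  (forall s, f (s * t)%g = f s) -> \big[addb/false]_s f s = false.
Proof.
move=> todd ft; rewrite (bigID (@odd_perm _)) /=.
rewrite (reindex_inj (mulIg t)) /=.
under eq_big => [s|s _]; first by rewrite odd_permM todd addbT; over.
  by rewrite ft; over.
by rewrite addbb.
Qed.

Lemma eq_addbF (a b : bool) : a = b -> a (+) b = false.
Proof. by move=> ->; rewrite addbb. Qed.

(* Faces omitting an inner vertex cancel in pairs, and the face of a simplex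
   opposite to its first vertex is opposite to the last vertex of a simplex of a
   neighbouring cube; by periodicity nothing is left over. *)
Lemma csum_coboundary (b : V -> bool) fs i : size fs = n' -> i <= n' ->
  (forall c x, b (translate c p.+1 x) = b x) ->
  (forall k, k < n' -> covariant (nth xpred0 fs k)) ->
  csum (take i fs ++ b :: drop i fs) = false.
Proof.
move=> sfs iN bper fcov.
pose m q s k := mcup i b fs (omit k (chain (corner q) s)).
have -> : csum (take i fs ++ b :: drop i fs) = \big[addb/false]_q
    \big[addb/false]_s \big[addb/false]_(k < n.+1) m q s k.
  apply: eq_bigr => q _; apply: eq_bigr => s _.
  rewrite -mcup_faces ?sfs // ?size_chain //.
under eq_bigr do rewrite exchange_big.
rewrite exchange_big big_ord_recr big_ord_recl /=.
rewrite [X in _ (+) X (+) _ ]big1 => [|k _].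
  rewrite addbF; apply: eq_addbF.
  rewrite exchange_big [RHS]exchange_big.
  rewrite [RHS](reindex_inj (mulIg rot_perm)); apply: eq_bigr => s _.
  rewrite /m; under eq_bigr do rewrite omit0_chain.
  apply: (sum_translate (B := fun x => mcup i b fs (omit n (chain x (s * rot_perm)%g)))) => x.
  rewrite translate_chain map_omit mcup_map // sfs => k kn y z; exact: fcov.
apply: big1 => q _.
pose i1 : 'I_n := inord k; pose i2 : 'I_n := inord k.+1.
have kn : k.+1 < n by rewrite ltnS.
apply: (@sum_invol _ (tperm i1 i2)).
  by rewrite odd_tperm -val_eqE /= !inordK //; lia.
by move=> s; rewrite /m (@omit_chain_tperm k) //= inordK //; lia.
Qed.

(* The labels live on the cover of the torus (Z/p.+1)^n; [winding i] is the class
   that changes exactly when the i-th coordinate runs once around. *)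
Definition winding i : V -> bool := fun x => odd (x i %/ p.+1).

Lemma winding_translate i c x :
  winding i (translate c p.+1 x) = winding i x (+) (i == c).
Proof. by rewrite /winding /translate addnC divnMDl // oddD oddb addbC. Qed.

Lemma winding_covariant i : covariant (winding i).
Proof.
move=> c x y; rewrite !winding_translate.
by case: (winding i x) (winding i y) (i == c) => [] [] [].
Qed.

Definition modv x : V := fun j => x j %% p.+1.

Lemma modv_translate c x : modv (translate c p.+1 x) = modv x.
Proof. by apply/funext => j; rewrite /modv /translate addnC modnMDl. Qed.

Section Labels.
Variable a : 'I_n -> V -> bool.

(** The coboundary differs from that of [winding i] by the coboundary of a periodic label, so the
    two are cohomologous on the torus. *)
Definition lift_label i : V -> bool := fun x => a i (modv x) (+) winding i x.

Lemma lift_label_covariant i : covariant (lift_label i).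
Proof.
move=> c x y; rewrite /lift_label !modv_translate !winding_translate.
case: (a i _) (a i _) => [] [];
by case: (winding i x) (winding i y) (i == c) => [] [] [].
Qed.

Definition hybrid m := mkseq (fun i =>
  if i < m then lift_label (inord i) else winding (inord i)) n.

Lemma hybrid_split m m' : m' < n ->
  hybrid m = take m' (hybrid m) ++
    (if m' < m then lift_label (inord m') else winding (inord m')) ::
    drop m'.+1 (hybrid m).
Proof.
move=> mn; rewrite -{1}(cat_take_drop m' (hybrid m)) (drop_nth xpred0) ?size_mkseq //.
by rewrite nth_mkseq.
Qed.

Lemma hybrid_covariant m k : k < n -> covariant (nth xpred0 (hybrid m) k).
Proof.
move=> kn; rewrite nth_mkseq //; case: ifP => _.
  exact: lift_label_covariant.
exact: winding_covariant.
Qed.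

Lemma take_hybrid m : m < n -> take m (hybrid m.+1) = take m (hybrid m).
Proof.
move=> mn; rewrite /hybrid /mkseq -!map_take take_iota; apply/eq_in_map => i.
by rewrite mem_iota => /andP[_ im]; rewrite (_ : (i < m.+1) = (i < m)) //; lia.
Qed.

Lemma drop_hybrid m : m < n -> drop m.+1 (hybrid m.+1) = drop m.+1 (hybrid m).
Proof.
move=> mn; rewrite /hybrid /mkseq -!map_drop drop_iota; apply/eq_in_map => i.
by rewrite mem_iota => /andP[mi _]; rewrite (_ : (i < m.+1) = (i < m)) //; lia.
Qed.

(** The products differ in slot [m] only, by the coboundary of the periodic label [b], and a product
    with such a factor sums to zero. *)
Lemma csum_hybridS m : m < n -> csum (hybrid m.+1) = csum (hybrid m).
Proof.
move=> mn.
rewrite (hybrid_split m.+1 mn) (hybrid_split m mn) ltnSn ltnn.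
rewrite take_hybrid // drop_hybrid //.
set l1 := take _ _; set l2 := drop _ _.
pose b x := a (inord m) (modv x).
have s1 : size l1 = m by rewrite size_takel // size_mkseq ltnW.
have s2 : size l2 = n' - m by rewrite size_drop size_mkseq subSS.
have E : csum (l1 ++ lift_label (inord m) :: l2) =
    csum (l1 ++ b :: l2) (+) csum (l1 ++ winding (inord m) :: l2).
  rewrite /csum -big_split; apply: eq_bigr => q _.
  rewrite -big_split; apply: eq_bigr => s _; apply: cup_add => //.
  by rewrite size_chain s1 s2 /n; lia.
have T1 : take m (l1 ++ l2) = l1 by rewrite take_size_cat.
have T2 : drop m (l1 ++ l2) = l2 by rewrite drop_size_cat.
rewrite E -{1}T1 -{2}T2 csum_coboundary //.
- by rewrite size_cat s1 s2; lia.
- by move=> c x; rewrite /b modv_translate.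
move=> k kn; rewrite nth_cat s1; case: ltnP => km.
  by rewrite nth_take //; apply: hybrid_covariant; lia.
by rewrite nth_drop; apply: hybrid_covariant; lia.
Qed.

Lemma nth_chain x s k : k <= n -> nth x (chain x s) k = vertex x s k.
Proof. by move=> kn; rewrite (nth_map 0) ?size_iota // nth_iota. Qed.

(** Slot [i] is nonzero only when step [i] carries coordinate [i] from [p] to [p.+1]. This forces
    the last cube and the identity order, so exactly one simplex counts. *)
Lemma csum_winding : csum (hybrid 0) = true.
Proof.
pose q0 : {ffun 'I_n -> 'I_p.+1} := [ffun=> ord_max].
have key q s i : (winding i (vertex (corner q) s i) (+) winding i (vertex (corner q) s i.+1)) =
    (q i == ord_max) && (s i == i).
  rewrite /winding /vertex /corner ltnS -!val_eqE /=.
  have := ltn_ord (q i); move: (nat_of_ord (q i)) => u; rewrite ltnS => up.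
  case: (ltngtP (s i) i) => _ /=; rewrite ?andbF ?andbT ?addbb // ?addn0 ?addn1.
  move: up; rewrite leq_eqVlt => /predU1P[->|up].
    by rewrite eqxx divnn divn_small.
  by rewrite !divn_small //=; lia.
have keyn q s i : (i < n)%N -> nth xpred0 (hybrid 0) i (nth (corner q) (chain (corner q) s) i)
      (+) nth xpred0 (hybrid 0) i (nth (corner q) (chain (corner q) s) i.+1) =
    (q (inord i) == ord_max) && (s (inord i) == inord i).
  move=> im; rewrite nth_mkseq // ltn0 !nth_chain // ?(ltnW im) //.
  by rewrite -[RHS]key !inordK.
have F q s : cup (hybrid 0) (chain (corner q) s) = (q == q0) && (s == 1%g).
  apply/idP/andP => [H|[/eqP -> /eqP ->]].
    have K i : (q i == ord_max) && (s i == i).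
      have := @cupP _ xpred0 (corner q) _ _ _ H i; rewrite size_mkseq size_chain.
      by rewrite keyn // inord_val; apply.
    split; apply/eqP; first by apply/ffunP => i; rewrite ffunE; apply/eqP; case/andP: (K i).
    by apply/permP => i; rewrite perm1; apply/eqP; case/andP: (K i).
  apply: (@cupT _ (corner q0) xpred0); rewrite size_mkseq ?size_chain // => i im.
  by rewrite keyn // ffunE perm1 !eqxx.
rewrite /csum; under eq_bigr do under eq_bigr do rewrite F.
rewrite (bigD1 q0) //= (bigD1 1%g) //= !eqxx !big1 // => [q /negPf->|s /negPf->] //.
by rewrite big1.
Qed.

(** The bound [q i < p] keeps the cube off the seam, where neighbours on the torus lie on opposite
    faces of the box. *)
Lemma kuhn : (forall i x, x i = 0 -> a i x = false) ->
    (forall i x, x i = p -> a i x = true) ->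
  exists q : V, forall i, (q i < p) /\ exists x y,
    [/\ forall j, q j <= x j <= (q j).+1, forall j, q j <= y j <= (q j).+1 &
      a i x && ~~ a i y].
Proof.
move=> a0 ap.
have : csum (hybrid n) = true.
  suff H m : m <= n -> csum (hybrid m) = true by exact: H.
  elim: m => [_|m IH mn]; first exact: csum_winding.
  by rewrite csum_hybridS // IH // ltnW.
rewrite /csum.
have [[q [s H]] _|NE] := pselect (exists q s, cup (hybrid n) (chain (corner q) s)); last first.
  rewrite big1 // => q _; rewrite big1 // => s _; apply/negbTE/negP => H.
  by apply: NE; exists q, s.
have {}H i : lift_label i (vertex (corner q) s i) (+) lift_label i (vertex (corner q) s i.+1).
  have := @cupP _ xpred0 (corner q) _ _ _ H i; rewrite size_mkseq size_chain.
  rewrite nth_mkseq // ltn_ord inord_val.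
  by rewrite !nth_chain //; [apply | exact: ltnW].
(* Across a seam the jump of the label is compensated by [winding]. *)
have qp i : q i < p.
  rewrite ltn_neqAle -ltnS ltn_ord andbT; apply/negP => /eqP qi.
  have C k : lift_label i (vertex (corner q) s k) = true.
    rewrite /lift_label; case: (boolP (s i < k)) => sk.
      rewrite a0; last by rewrite /modv /vertex /corner qi sk addn1 modnn.
      by rewrite /winding /vertex /corner qi sk addn1 divnn.
    rewrite ap; last by rewrite /modv /vertex /corner qi (negbTE sk) addn0 modn_small.
    by rewrite /winding /vertex /corner qi (negbTE sk) addn0 divn_small.
  by have := H i; rewrite !C.
have C i k : lift_label i (vertex (corner q) s k) = a i (vertex (corner q) s k).
  have L j : vertex (corner q) s k j < p.+1.
    rewrite /vertex /corner; have := qp j; case: (_ < k); lia.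
  rewrite /lift_label /winding divn_small // addbF; congr a.
  by apply/funext => j; rewrite /modv modn_small.
have B k j : corner q j <= vertex (corner q) s k j <= (corner q j).+1.
  by rewrite /vertex; case: (_ < k); lia.
exists (corner q) => i; split; first exact: qp.
have := H i; rewrite !C.
have [Ha|Ha] := boolP (a i (vertex (corner q) s i)) => /= Hb.
  by exists (vertex (corner q) s i), (vertex (corner q) s i.+1); rewrite Ha.
by exists (vertex (corner q) s i.+1), (vertex (corner q) s i); rewrite Hb.
Qed.

End Labels.
End Kuhn.


Import Order.TTheory GRing.Theory Num.Theory.
Import numFieldNormedType.Exports.
Local Open Scope classical_set_scope.
Local Open Scope ring_scope.

(** * From labelled grids to fixed points *)

Section Brouwer.
Variable R : realType.

(** Label [i] tells whether coordinate [i] of [f] lies below that of the point. The cells carrying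
    both values of all labels accumulate at a point where neither strict inequality can hold. *)
Lemma brouwer n (f : 'rV[R]_n -> 'rV[R]_n) (B : R) :
  continuous f -> (forall x i, `|f x 0 i| <= B) -> exists x, f x = x.
Proof.
case: n f => [|n'] f fc fB; first by exists 0; apply/rowP => -[].
(* The margin makes the box nondegenerate and [f] strictly smaller than the coordinate on its upper
   faces. *)
pose C := B + 1.
have B0 : 0 <= B by apply: le_trans (fB 0 0); exact: normr_ge0.
have C0 : 0 < C by rewrite ltr_wpDl.
pose pt (m : nat) (x : 'I_n'.+1 -> nat) : 'rV[R]_n'.+1 :=
  \row_j (- C + 2 * C / m.+1%:R * (x j)%:R).
pose near_grid (q x : 'I_n'.+1 -> nat) := (forall j, q j <= x j <= (q j).+1)%N.
have grid m : exists q : 'I_n'.+1 -> nat, forall i, (q i < m.+1)%N /\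
    exists x y, [/\ near_grid q x, near_grid q y &
     (f (pt m x) 0 i < pt m x 0 i) && ~~ (f (pt m y) 0 i < pt m y 0 i)].
  apply: (@kuhn n' m.+1 (fun i x => f (pt m x) 0 i < pt m x 0 i)) => i x xi.
    apply/negbTE; rewrite -leNgt mxE xi mulr0 addr0.
    by have := fB (pt m x) i; rewrite ler_norml => /andP[? _]; rewrite /C; lra.
  rewrite mxE xi divfK ?pnatr_eq0 //.
  by have := fB (pt m x) i; rewrite ler_norml => /andP[_ ?]; rewrite /C; lra.
have [q Hq] := choice grid.
pose b m := pt m (q m).
pose A := [set M : 'rV[R]_n'.+1 | forall j, `[- C, C]%classic (M ord0 j)].
have cA : compact A.
  by apply: (@rV_compact _ _ (fun=> `[- C, C]%classic)) => _; exact: segment_compact.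
have bA m : A (b m).
  move=> j; rewrite /= mxE in_itv /=.
  have [qm _] := Hq m j.
  have m0 : 0 < m.+1%:R :> R by rewrite ltr0n.
  have qm' : (q m j)%:R / m.+1%:R <= 1 :> R by rewrite ler_pdivrMr // mul1r ler_nat ltnW.
  have q0 : 0 <= (q m j)%:R / m.+1%:R :> R by rewrite divr_ge0.
  rewrite (_ : 2 * C / m.+1%:R * (q m j)%:R = 2 * C * ((q m j)%:R / m.+1%:R)); last by ring.
  by move: ((q m j)%:R / m.+1%:R) q0 qm' => u u0 u1; apply/andP; split; nra.
have [x [_ clx]] : A `&` cluster (b @ \oo) !=set0.
  by apply: cA; apply: (@filterE _ \oo _ (b @^-1` A)) => m; exact: bA.
have grid_dist m y : near_grid (q m) y -> `|b m - pt m y| <= 2 * C / m.+1%:R.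
  move=> qy; rewrite [`|_|]mx_normrE; apply/bigmax_leP; split=> [|[i j] _].
    by rewrite divr_ge0 // mulr_ge0 // ltW.
  rewrite /= !mxE (_ : - C + _ - _ = 2 * C / m.+1%:R * ((q m j)%:R - (y j)%:R)); last by ring.
  rewrite normrM ger0_norm; last by rewrite divr_ge0 // mulr_ge0 // ltW.
  rewrite ler_piMr //; first by rewrite divr_ge0 // mulr_ge0 // ltW.
  have /andP[q1 q2] := qy j.
  rewrite distrC -natrB // ger0_norm // lern1; lia.
(* A neighbourhood of [x] contains a whole grid cell, not just its corner, hence points with both
   values of each label. *)
have approx (P : set 'rV[R]_n'.+1) : nbhs x P -> exists m, forall y, near_grid (q m) y -> P (pt m y).
  move=> /nbhs_ballP[e e0 eP].
  have e2 : 0 < e / 2 by rewrite divr_gt0.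
  have small : \forall m \near \oo, 2 * C / m.+1%:R < e / 2.
    near=> m.
    rewrite ltr_pdivrMr ?ltr0n // -ltr_pdivrMl //.
    apply: (@lt_le_trans _ _ (m%:R : R)); last by rewrite ler_nat.
    by near: m; exact: nbhs_infty_gtr.
  have [M [[m [sm bm]] xM]] : [set M | exists m, 2 * C / m.+1%:R < e / 2 /\ b m = M] `&` ball x (e / 2) !=set0.
    apply: clx; last exact: nbhsx_ballx.
    by apply: filterS small => m sm; exists m.
  exists m => y qy; apply: eP; rewrite -bm in xM.
  rewrite (splitr e); apply: ball_triangle xM _.
  by rewrite -ball_normE /=; apply: le_lt_trans (grid_dist _ _ qy) sm.
exists x; apply/rowP => i; apply/eqP; rewrite eq_le; apply/andP; split.
  rewrite leNgt; apply/negP => lt_i.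
  have [m Hm] : exists m, forall y, near_grid (q m) y -> pt m y 0 i < f (pt m y) 0 i.
    apply: (approx (fun M => M 0 i < f M 0 i)).
    have c1 : {for x, continuous (fun M : 'rV[R]_n'.+1 => f M 0 i - M 0 i)}.
      apply: continuousB; last exact: coord_continuous.
      by apply: (@continuous_comp _ _ _ f (fun N : 'rV[R]_n'.+1 => N 0 i)); [exact: fc|exact: coord_continuous].
    have : nbhs x (fun M : 'rV[R]_n'.+1 => 0 < f M 0 i - M 0 i).
      by move: c1 => /cvgr_gt; apply; rewrite subr_gt0.
    by apply: filterS => M /=; rewrite subr_gt0.
  have [_ [y [_ [qy _ /andP[+ _]]]]] := Hq m i.
  by rewrite ltNge ltW // Hm.
rewrite leNgt; apply/negP => lt_i.
have [m Hm] : exists m, forall y, near_grid (q m) y -> f (pt m y) 0 i < pt m y 0 i.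
  apply: (approx (fun M => f M 0 i < M 0 i)).
  have c1 : {for x, continuous (fun M : 'rV[R]_n'.+1 => M 0 i - f M 0 i)}.
    apply: continuousB; first exact: coord_continuous.
    by apply: (@continuous_comp _ _ _ f (fun N : 'rV[R]_n'.+1 => N 0 i)); [exact: fc|exact: coord_continuous].
  have : nbhs x (fun M : 'rV[R]_n'.+1 => 0 < M 0 i - f M 0 i).
    by move: c1 => /cvgr_gt; apply; rewrite subr_gt0.
  by apply: filterS => M /=; rewrite subr_gt0.
have [_ [_ [y [_ qy /andP[_]]]]] := Hq m i.
by rewrite Hm.
Unshelve. all: by end_near. Qed.

End Brouwer.

(** * The Hilbert scale *)

Section HScale.
Variable R : realType.
Implicit Types (s : R) (f g : nzint -> Rcomplex R) (z w : Rcomplex R).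

Lemma rnormcM z w : `|(z * w : Rcomplex R)| = `|z| * `|w|.
Proof. exact: Normc.normcM. Qed.

Lemma rnormc_sqr z : `|z| ^+ 2 = complex.Re z ^+ 2 + complex.Im z ^+ 2.
Proof. by case: z => a b; rewrite /Num.norm /= sqr_sqrtr // addr_ge0 ?sqr_ge0. Qed.

Lemma rnormc_Re z : `|complex.Re z| <= `|z|.
Proof.
rewrite -(ler_pXn2r (n := 2)) ?nnegrE ?normr_ge0 // rnormc_sqr.
by rewrite real_normK ?num_real // lerDl sqr_ge0.
Qed.

Lemma rnormc_Im z : `|complex.Im z| <= `|z|.
Proof.
rewrite -(ler_pXn2r (n := 2)) ?nnegrE ?normr_ge0 // rnormc_sqr.
by rewrite real_normK ?num_real // lerDr sqr_ge0.
Qed.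

Lemma rnormc_le z : `|z| <= `|complex.Re z| + `|complex.Im z|.
Proof.
rewrite -(ler_pXn2r (n := 2)) ?nnegrE ?addr_ge0 ?normr_ge0 // rnormc_sqr.
rewrite sqrrD !real_normK ?num_real // -addrAC lerDl.
by rewrite mulrn_wge0 // mulr_ge0.
Qed.

Definition size_of (n : nzint) : R := `|val n|%N%:R.

Lemma size_of_ge1 n : 1 <= size_of n.
Proof. by rewrite ler1n absz_gt0; exact: valP n. Qed.

Lemma size_of_gt0 n : 0 < size_of n.
Proof. exact: lt_le_trans (size_of_ge1 n). Qed.

Lemma hweight_ge0 s n : 0 <= hweight s n.
Proof. by rewrite ltW // hweight_gt0. Qed.

Lemma hweight0 n : hweight 0 n = 1 :> R.
Proof. by rewrite /hweight mulr0 powRr0. Qed.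

Lemma hweightE s n : hweight s n = (size_of n `^ s) ^+ 2.
Proof. by rewrite /hweight mulrC powRrM powR_mulrn // powR_ge0. Qed.

Lemma le_hweight s s' n : s <= s' -> hweight s n <= hweight s' n.
Proof. by move=> ss; apply: ler_powR; rewrite ?size_of_ge1 // ler_pM2l. Qed.

(* |f|_s <= B, tested on finite partial sums. *)
Definition hbnd s (B : R) f : Prop := forall r : seq nzint, uniq r ->
  \sum_(n <- r) hweight s n * `|f n| ^+ 2 <= B ^+ 2.

Lemma hbnd_in s B f : hbnd s B f -> f \in in_hscale s.
Proof.
by move=> fB; apply: (@le_lt_trans _ _ (B ^+ 2)%:E); [exact: hsqnorm_le | exact: ltry].
Qed.

Lemma hscale_ext s (u v : hscale s) : u =1 v -> u = v.
Proof. by move=> uv; apply/val_inj/funext. Qed.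

Lemma hnorm_hbnd s (u : hscale s) : hbnd s `|u| u.
Proof.
move=> r ur; apply: le_trans (hsqnorm_ge ur (coefP u)) _.
by rewrite sqr_sqrtr // fine_ge0 // hsqnorm_ge0.
Qed.

Lemma hnorm_le s B (u : hscale s) : 0 <= B -> hbnd s B u -> `|u| <= B.
Proof.
move=> B0 uB; rewrite -[leRHS]ger0_norm // -sqrtr_sqr ler_wsqrtr //.
rewrite -lee_fin fineK; first exact: hsqnorm_le.
by rewrite ge0_fin_numE ?hsqnorm_ge0 //; exact: (coefP u).
Qed.

Lemma hbnd_coef s B f n : 0 <= B -> hbnd s B f -> size_of n `^ s * `|f n| <= B.
Proof.
move=> B0 /(_ [:: n] isT); rewrite big_seq1 hweightE -exprMn.
by rewrite ler_pXn2r // nnegrE // mulr_ge0 // powR_ge0.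
Qed.

Lemma coef_le (u : hscale (0 : R)) n : `|u n| <= `|u|.
Proof.
have := @hbnd_coef 0 `|u| u n (normr_ge0 u) (@hnorm_hbnd (0 : R) u).
by rewrite powRr0 mul1r.
Qed.

(** Multipliers of order [s - s'], which map H_s to H_s'. Embeddings and the inverse small divisors
    are both of this kind. *)
Definition coef_bounded s s' (C : R) (m : nzint -> Rcomplex R) : Prop :=
  0 <= C /\ forall n, `|m n| <= C * size_of n `^ (s - s').

Lemma hbnd_mult s s' C m B f : coef_bounded s s' C m -> hbnd s B f ->
  hbnd s' (C * B) (fun n => m n * f n).
Proof.
move=> [C0 mC] fB r ur; rewrite exprMn.
apply: le_trans (ler_wpM2l (sqr_ge0 _) (fB r ur)).
rewrite big_distrr /=; apply: ler_sum => n _.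
rewrite !hweightE rnormcM -!exprMn ler_pXn2r ?nnegrE ?mulr_ge0 ?powR_ge0 //.
rewrite !mulrA ler_wpM2r // mulrC.
apply: le_trans (ler_wpM2r (powR_ge0 _ _) (mC n)) _.
by rewrite -mulrA -powRD ?subrK // (gt_eqF (size_of_gt0 n)) implybT.
Qed.

Definition mult s s' C m (mC : coef_bounded s s' C m) (u : hscale s) : hscale s' :=
  HScale (hbnd_in (hbnd_mult mC (@hnorm_hbnd s u))).

Lemma mult_norm s s' C m (mC : coef_bounded s s' C m) u : `|mult mC u| <= C * `|u|.
Proof.
apply: hnorm_le; first by rewrite mulr_ge0 //; case: mC.
exact: hbnd_mult (@hnorm_hbnd _ _).
Qed.

Lemma coefD s (u v : hscale s) n : (u + v) n = u n + v n. Proof. by []. Qed.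
Lemma coefN s (u : hscale s) n : (- u) n = - u n. Proof. by []. Qed.
Lemma coefB s (u v : hscale s) n : (u - v) n = u n - v n. Proof. by []. Qed.
Lemma coefZ s a (u : hscale s) n : (a *: u) n = a *: u n. Proof. by []. Qed.

Lemma rscalerAr a z w : z * (a *: w) = a *: (z * w).
Proof. by case: z w => [x y] [x' y']; congr Complex; ring. Qed.

Lemma mult_linear s s' C m (mC : coef_bounded s s' C m) : linear (mult mC).
Proof.
by move=> a u v; apply: hscale_ext => n; rewrite /= mulrDr rscalerAr.
Qed.

HB.instance Definition _ s s' C m (mC : coef_bounded s s' C m) :=
  GRing.isLinear.Build R (hscale s) (hscale s') _ (mult mC) (mult_linear mC).

Lemma coef_bounded1 s s' : s' <= s -> coef_bounded s s' 1 (fun=> 1).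
Proof.
move=> ss; split=> // n; rewrite mul1r (_ : `|(1 : Rcomplex R)| = 1); last exact: Normc.normc1.
by rewrite -(powRr0 (size_of n)) ler_powR ?size_of_ge1 // subr_ge0.
Qed.

Definition emb s s' (ss : s' <= s) : hscale s -> hscale s' := mult (coef_bounded1 ss).

HB.instance Definition _ s s' (ss : s' <= s) := GRing.Linear.on (emb ss).

Lemma embE s s' (ss : s' <= s) u : emb ss u =1 u.
Proof. by move=> n; rewrite /= mul1r. Qed.

Lemma emb_norm s s' (ss : s' <= s) u : `|emb ss u| <= `|u|.
Proof. by rewrite -[leRHS]mul1r; exact: mult_norm. Qed.

Lemma rot_norm s m (m1 : forall n, `|m n| = 1) (u : hscale s) : `|Defs.rot m1 u| = `|u|.
Proof.
congr (Num.sqrt (fine _)); apply: eq_esum => n _.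
by rewrite /= rnormcM m1 mul1r.
Qed.

Lemma rot_linear s m (m1 : forall n, `|m n| = 1) : linear (@Defs.rot R s m m1).
Proof. by move=> a u v; apply: hscale_ext => n; rewrite /= mulrDr rscalerAr. Qed.

HB.instance Definition _ s m (m1 : forall n, `|m n| = 1) :=
  GRing.isLinear.Build R (hscale s) (hscale s) _ (Defs.rot m1) (@rot_linear s m m1).
HB.instance Definition _ s := GRing.Linear.on (@J R s).
HB.instance Definition _ s d X t := GRing.Linear.on (@flowA R s d X t).

Section LinearRules.
Variables (s s' : R) (ss : s' <= s).
Implicit Types u v : hscale s.

Lemma J_add u v : J (u + v) = J u + J v. Proof. exact: linearD. Qed.
Lemma J_sub u v : J (u - v) = J u - J v. Proof. exact: linearB. Qed.
Lemma J_scale a u : J (a *: u) = a *: J u. Proof. exact: linearZ. Qed.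
Lemma J_0 : J (0 : hscale s) = 0. Proof. exact: linear0. Qed.
Lemma flowA_add d X t u v : flowA d X t (u + v) = flowA d X t u + flowA d X t v.
Proof. exact: linearD. Qed.
Lemma flowA_sub d X t u v : flowA d X t (u - v) = flowA d X t u - flowA d X t v.
Proof. exact: linearB. Qed.
Lemma flowA_scale d X t a u : flowA d X t (a *: u) = a *: flowA d X t u.
Proof. exact: linearZ. Qed.
Lemma emb_add u v : emb ss (u + v) = emb ss u + emb ss v. Proof. exact: linearD. Qed.
Lemma emb_sub u v : emb ss (u - v) = emb ss u - emb ss v. Proof. exact: linearB. Qed.
Lemma emb_scale a u : emb ss (a *: u) = a *: emb ss u. Proof. exact: linearZ. Qed.
Lemma emb_0 : emb ss 0 = 0. Proof. exact: linear0. Qed.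
Lemma emb_sum I (r : seq I) (F : I -> hscale s) :
  emb ss (\sum_(i <- r) F i) = \sum_(i <- r) emb ss (F i).
Proof. exact: linear_sum. Qed.
Lemma mult_sub C m (mC : coef_bounded s s' C m) u v : mult mC (u - v) = mult mC u - mult mC v.
Proof. exact: linearB. Qed.

End LinearRules.

Lemma J_norm s (u : hscale s) : `|J u| = `|u|. Proof. exact: rot_norm. Qed.
Lemma flowA_norm s d X t (u : hscale s) : `|flowA d X t u| = `|u|.
Proof. exact: rot_norm. Qed.

Lemma cisD (x y : R) : cis (x + y) = cis x * cis y.
Proof.
rewrite /cis cosD sinD; congr Complex; ring.
Qed.

Lemma cis0 : cis 0 = 1 :> Rcomplex R.
Proof. by rewrite /cis cos0 sin0. Qed.

Lemma flowAD s d X t t' (u : hscale s) :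
  flowA d X (t + t') u = flowA d X t (flowA d X t' u).
Proof. by apply: hscale_ext => n; rewrite /= mulrDl cisD mulrA. Qed.

Lemma flowA0 s d X (u : hscale s) : flowA d X 0 u = u.
Proof. by apply: hscale_ext => n; rewrite /= mul0r cis0 mul1r. Qed.

Lemma flowANK s d X t (u : hscale s) : flowA d X t (flowA d X (- t) u) = u.
Proof. by rewrite -flowAD subrr flowA0. Qed.

End HScale.

(** [Negz k] is -(k + 1), hence the shorter second range; [insub] discards 0. *)
Definition modes (N : nat) : seq nzint :=
  pmap insub ([seq Posz k | k <- iota 0 N.+1] ++ [seq Negz k | k <- iota 0 N]).

Lemma mem_modes N n : (n \in modes N) = (`|val n| <= N)%N.
Proof.
rewrite /modes mem_pmap_sub mem_cat.
case: (val n) => k.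
  rewrite mem_map ?mem_iota //; last by move=> ? ? [].
  rewrite (_ : (_ \in [seq Negz _ | _ <- _]) = false); last first.
    by apply/negbTE/negP => /mapP[].
  by rewrite orbF /= add0n ltnS.
rewrite [X in _ || X]mem_map ?mem_iota //; last by move=> ? ? [].
rewrite (_ : (_ \in [seq Posz _ | _ <- _]) = false); last first.
  by apply/negbTE/negP => /mapP[].
by rewrite /= add0n.
Qed.

Lemma modes_uniq N : uniq (modes N).
Proof.
apply: pmap_sub_uniq; rewrite cat_uniq !map_inj_uniq ?iota_uniq /=; try by move=> ? ? [].
by rewrite andbT; apply/hasPn => x /mapP[k _ ->]; apply/negP => /mapP[].
Qed.

(** * Compactness of the embedding of H_s into H *)

Section Compactness.
Variable R : realType.
Implicit Types (s B : R).

Lemma near_seq (I : Type) (F : set_system I) {FF : Filter F} (T : eqType) (r : seq T)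
    (P : T -> I -> Prop) : (forall n, n \in r -> \forall i \near F, P n i) ->
  \forall i \near F, forall n, n \in r -> P n i.
Proof.
elim: r => [|n r IH] H; first by apply: nearW.
have H1 := H n (mem_head _ _).
have H2 := IH (fun m mr => H m (@mem_behead _ (n :: r) m mr)).
apply: filterS2 H1 H2 => i Pn Pr m; rewrite inE => /predU1P[->//|]; exact: Pr.
Qed.

(** Beyond the cutoff the weights gain a factor A^2 with A = (B + 1) / eps; the added 1 keeps A
    positive when B = 0. *)
Lemma hbnd_tail s s' B (eps : R) : s' < s -> 0 <= B -> 0 < eps ->
  exists N, forall f : nzint -> Rcomplex R, hbnd s B f -> forall r, uniq r ->
    (forall n, n \in r -> n \notin modes N) ->
    \sum_(n <- r) hweight s' n * `|f n| ^+ 2 <= eps ^+ 2.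
Proof.
rewrite -subr_gt0 => s0 B0 e0; pose A := (B + 1) / eps.
have A0 : 0 < A by rewrite divr_gt0 // ltr_wpDl.
exists (Num.truncn (A `^ (s - s')^-1)) => f fB r ur rN.
have big n : n \in r -> A <= size_of R n `^ (s - s').
  move=> /rN; rewrite mem_modes -ltnNge => nN.
  have -> : A = (A `^ (s - s')^-1) `^ (s - s') by rewrite -powRrM mulVf ?gt_eqF // powRr1 // ltW.
  apply: ge0_ler_powR; rewrite ?nnegrE ?powR_ge0 ?(ltW s0) //.
  by rewrite (le_trans (ltW (truncnS_gt _))) // ler_nat.
have H : A ^+ 2 * \sum_(n <- r) hweight s' n * `|f n| ^+ 2 <= (B + 1) ^+ 2.
  apply: (@le_trans _ _ (B ^+ 2)); last first.
    by rewrite ler_pXn2r ?nnegrE ?addr_ge0 // lerDl.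
  apply: le_trans (fB r ur); rewrite big_distrr /= big_seq [leRHS]big_seq.
  apply: ler_sum => n nr; rewrite mulrA ler_wpM2r ?sqr_ge0 //.
  have -> : hweight s n = (size_of R n `^ (s - s')) ^+ 2 * hweight s' n.
    rewrite !hweightE -exprMn -powRD ?subrK //.
    by rewrite (gt_eqF (size_of_gt0 R n)) implybT.
  rewrite ler_wpM2r ?hweight_ge0 //.
  by rewrite ler_pXn2r ?nnegrE ?powR_ge0 ?(ltW A0) // big.
rewrite -ler_pdivlMl ?exprn_gt0 // in H.
apply: le_trans H _; rewrite -exprVn -exprMn (_ : _ * _ = eps) // /A.
by field; rewrite (gt_eqF e0) gt_eqF // ltr_wpDl.
Qed.

(** The bound in H_s makes the tail uniformly small, and finitely many modes remain. The filter is
    left general because the lemma serves both limits of approximations and continuity in time. *)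
Lemma hbnd_cvg0 (I : Type) (F : set_system I) {FF : Filter F} s B
    (w : I -> hscale (0 : R)) : 0 < s -> 0 <= B ->
  (\forall i \near F, hbnd s B (w i)) ->
  (forall n (eps : R), 0 < eps -> \forall i \near F, `|w i n| <= eps) ->
  forall eps : R, 0 < eps -> \forall i \near F, `|w i| <= eps.
Proof.
move=> s0 B0 wB wn eps e0.
have [N HN] := hbnd_tail s0 B0 (divr_gt0 e0 (ltr0n R 2)).
pose K := (size (modes N)).+1.
have K0 : 0 < K%:R :> R by rewrite ltr0n.
have d0 : 0 < eps / (2 * K%:R) by rewrite divr_gt0 // mulr_gt0.
have Hm := near_seq (r := modes N) (P := fun n i => `|w i n| <= eps / (2 * K%:R))
  (fun n _ => wn n _ d0).
apply: filterS2 wB (Hm FF) => i wi wm; apply: hnorm_le (ltW e0) _ => r ur.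
under eq_bigr do rewrite hweight0 mul1r.
rewrite (bigID (mem (modes N))) /= -big_filter -[X in _ + X]big_filter.
have T1 : \sum_(n <- [seq n <- r | n \in modes N]) `|w i n| ^+ 2 <= (eps / 2) ^+ 2.
  apply: (@le_trans _ _ (\sum_(n <- [seq n <- r | n \in modes N]) (eps / (2 * K%:R)) ^+ 2)).
    rewrite big_seq [leRHS]big_seq; apply: ler_sum => n; rewrite mem_filter => /andP[nm _].
    by rewrite ler_pXn2r ?nnegrE ?(ltW d0) // wm.
  rewrite big_const_seq count_predT iter_addr_0.
  have sK : (size [seq n <- r | n \in modes N] <= K)%N.
    apply: leqW; apply: uniq_leq_size; first exact: filter_uniq.
    by move=> n; rewrite mem_filter => /andP[].
  rewrite -[leLHS]mulr_natr invfM mulrA [in leLHS]exprMn -[leLHS]mulrA ler_piMr ?sqr_ge0 //.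
  rewrite exprVn mulrC ler_pdivrMr ?exprn_gt0 // mul1r.
  apply: le_trans (_ : K%:R <= _); first by rewrite ler_nat.
  by rewrite expr2 ler_peMr ?ler1n // ltW.
have T2 : \sum_(n <- [seq n <- r | n \notin modes N]) `|w i n| ^+ 2 <= (eps / 2) ^+ 2.
  rewrite (eq_bigr (fun n => hweight 0 n * `|w i n| ^+ 2)) => [|n _]; last first.
    by rewrite hweight0 mul1r.
  apply: HN => //; first exact: filter_uniq.
  by move=> n; rewrite mem_filter => /andP[].
apply: le_trans (lerD T1 T2) _.
by have := sqr_ge0 eps; lra.
Qed.

Lemma hbndW s B B' (f : nzint -> Rcomplex R) : 0 <= B -> B <= B' -> hbnd s B f -> hbnd s B' f.
Proof.
move=> B0 BB fB r ur; apply: le_trans (fB r ur) _.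
by rewrite ler_pXn2r ?nnegrE // (le_trans B0).
Qed.

Lemma hbndB s B B' (f g : nzint -> Rcomplex R) : 0 <= B -> 0 <= B' ->
  hbnd s B f -> hbnd s B' g -> hbnd s (B + B') (f - g).
Proof.
move=> B0 B'0 fB gB.
have uB : `|HScale (hbnd_in fB)| <= B by exact: hnorm_le.
have vB : `|HScale (hbnd_in gB)| <= B' by exact: hnorm_le.
apply: hbndW (hnorm_hbnd (HScale (hbnd_in fB) - HScale (hbnd_in gB))) => //.
by apply: le_trans (ler_normB _ _) _; exact: lerD.
Qed.

(** Compactness gives a cluster point. An ultrafilter contains each neighbourhood of it or the
    complement, and the complement is incompatible with clustering. *)
Lemma ultra_bounded_cvg (I : Type) (U : set_system I) (x : I -> R) B :
  UltraFilter U -> (\forall i \near U, `|x i| <= B) -> exists p : R, x @ U --> p.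
Proof.
move=> UU xB.
have [p [_ clp]] : `[- B, B]%classic `&` cluster (x @ U) !=set0.
  apply: (segment_compact (a := - B) (b := B)).
  by apply: filterS xB => i; rewrite /= in_itv /= ler_norml.
exists p; apply/cvgrPdist_lt => e e0.
have [//|UC] := in_ultra_setVsetC [set i | `|p - x i| < e] UU.
have [y [yB]] : [set y : R | ~ `|p - y| < e] `&` ball p e !=set0.
  by apply: clp; [exact: UC | exact: nbhsx_ballx].
by rewrite -ball_normE /= => /yB.
Qed.

Lemma hbnd_lim (I : Type) (F : set_system I) {FF : ProperFilter F} s B
    (w : I -> nzint -> Rcomplex R) (u : nzint -> Rcomplex R) :
  (\forall i \near F, hbnd s B (w i)) ->
  (forall n, complex.Re (w i n) @[i --> F] --> complex.Re (u n)) ->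
  (forall n, complex.Im (w i n) @[i --> F] --> complex.Im (u n)) -> hbnd s B u.
Proof.
move=> wB re im r ur.
have C : \sum_(n <- r) hweight s n * `|w i n| ^+ 2 @[i --> F] -->
    \sum_(n <- r) hweight s n * `|u n| ^+ 2.
  elim: (r) => [|n q IH].
    by under eq_fun do rewrite big_nil; rewrite big_nil; exact: cvg_cst.
  under eq_fun do rewrite big_cons; rewrite big_cons.
  apply: cvgD IH; apply: cvgMr; rewrite rnormc_sqr; under eq_fun do rewrite rnormc_sqr.
  by apply: cvgD; rewrite !expr2; under eq_fun do rewrite expr2; apply: cvgM.
rewrite -(cvg_lim (@Rhausdorff R) C); apply: limr_le; first by apply/cvg_ex; eexists; exact: C.
by apply: filterS wB => i; exact.
Qed.

(** The ultrafilter replaces a diagonal subsequence: all coefficients converge along it, the limit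
    inherits the bound, and [hbnd_cvg0] gives convergence in norm. *)
Lemma hbnd_compact (I : Type) (U : set_system I) s B (w : I -> hscale (0 : R)) :
  UltraFilter U -> 0 < s -> 0 <= B -> (\forall i \near U, hbnd s B (w i)) ->
  exists u : hscale (0 : R), hbnd s B u /\
    forall eps : R, 0 < eps -> \forall i \near U, `|w i - u| <= eps.
Proof.
move=> UU s0 B0 wB.
have cB i n : hbnd s B (w i) -> `|w i n| <= B.
  move=> /(hbnd_coef n B0); apply: le_trans; rewrite ler_peMl //.
  by rewrite -(powRr0 (size_of R n)) ler_powR ?size_of_ge1 // ltW.
have [p Hp] : exists p : nzint -> R, forall n, complex.Re (w i n) @[i --> U] --> p n.
  have K n : exists p : R, complex.Re (w i n) @[i --> U] --> p.
    apply: (@ultra_bounded_cvg _ _ _ B) => //.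
    by apply: filterS wB => i /(cB _ n); apply: le_trans; exact: rnormc_Re.
  by have [p Hp] := choice K; exists p.
have [q Hq] : exists q : nzint -> R, forall n, complex.Im (w i n) @[i --> U] --> q n.
  have K n : exists p : R, complex.Im (w i n) @[i --> U] --> p.
    apply: (@ultra_bounded_cvg _ _ _ B) => //.
    by apply: filterS wB => i /(cB _ n); apply: le_trans; exact: rnormc_Im.
  by have [q Hq] := choice K; exists q.
pose f n : Rcomplex R := Complex (p n) (q n).
have fB : hbnd s B f by apply: hbnd_lim wB _ _.
have f0 : f \in in_hscale (0 : R).
  apply: (@hbnd_in _ 0 B) => r ur; apply: le_trans (fB r ur).
  by apply: ler_sum => n _; rewrite ler_wpM2r ?sqr_ge0 // le_hweight // ltW.
exists (HScale f0); split => //.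
apply: (@hbnd_cvg0 _ _ _ s (B + B)) => //; first exact: addr_ge0.
  by apply: filterS wB => i wi; exact: hbndB.
move=> n e e0; have e2 : 0 < e / 2 by rewrite divr_gt0.
have /cvgrPdist_le/(_ _ e2) H1 := Hp n.
have /cvgrPdist_le/(_ _ e2) H2 := Hq n.
apply: filterS2 H1 H2 => i h1 h2.
apply: le_trans (rnormc_le _) _; rewrite (splitr e); apply: lerD.
  rewrite (_ : complex.Re _ = complex.Re (w i n) - p n) 1?distrC //.
  by rewrite coefB /=; case: (w i n).
rewrite (_ : complex.Im _ = complex.Im (w i n) - q n) 1?distrC //.
by rewrite coefB /=; case: (w i n).
Qed.

End Compactness.

(** * Schauder's fixed point theorem *)

Section Schauder.
Variable R : realType.
Implicit Types (s B : R).

Lemma finsupp_hbnd N (M : R) (f : nzint -> Rcomplex R) : 0 <= M ->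
  (forall n, n \notin modes N -> f n = 0) -> (forall n, `|f n| <= M) ->
  hbnd 0 ((size (modes N))%:R * M) f.
Proof.
move=> M0 f0 fM r ur; under eq_bigr do rewrite hweight0 mul1r.
rewrite (bigID (mem (modes N))) /= [X in _ + X]big1 ?addr0; last first.
  by move=> n /f0 ->; rewrite normr0 expr0n.
rewrite -big_filter; apply: (@le_trans _ _ (\sum_(n <- [seq n <- r | n \in modes N]) M ^+ 2)).
  by apply: ler_sum => n _; rewrite ler_pXn2r ?nnegrE.
rewrite big_const_seq count_predT iter_addr_0 exprMn -[leLHS]mulr_natl.
rewrite ler_wpM2r ?sqr_ge0 // -natrX ler_nat.
apply: (@leq_trans (size (modes N))); last by rewrite -mulnn; case: (size _) => // k; rewrite leq_pmulr.
apply: uniq_leq_size; first exact: filter_uniq.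
by move=> n; rewrite mem_filter => /andP[].
Qed.

Section Galerkin.
Variable N : nat.
Let K := size (modes N).

(** Real parts fill the first half of the row, imaginary parts the second. Outside the list [index]
    returns [K], where [insub] fails, so the coefficient is 0. *)
Definition mode_coef (x : 'rV[R]_(K + K)) (n : nzint) : Rcomplex R :=
  if insub (index n (modes N)) is Some j
  then Complex (x 0 (lshift K j)) (x 0 (rshift K j)) else 0.

Lemma mode_coef_out x n : n \notin modes N -> mode_coef x n = 0.
Proof. by move=> nN; rewrite /mode_coef insubN // -leqNgt memNindex. Qed.

Lemma mode_coef_in x (j : 'I_K) :
  mode_coef x (tnth (in_tuple (modes N)) j) =
  Complex (x 0 (lshift K j)) (x 0 (rshift K j)).
Proof.
rewrite /mode_coef; set k := index _ _.
have -> : k = j by rewrite /k (tnth_nth (tnth (in_tuple (modes N)) j)) index_uniq // modes_uniq.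
by rewrite valK.
Qed.

Lemma row_coord_le (x : 'rV[R]_(K + K)) i : `|x 0 i| <= `|x|.
Proof.
by rewrite [leRHS]mx_normrE (bigmax_sup (0, i)).
Qed.

Lemma mode_coef_norm x n : `|mode_coef x n| <= `|x| + `|x|.
Proof.
rewrite /mode_coef; case: insub => [j|]; last by rewrite normr0 addr_ge0.
by apply: le_trans (rnormc_le _) _; rewrite lerD //= row_coord_le.
Qed.

Lemma mode_coef_hbnd x : hbnd 0 (K%:R * (`|x| + `|x|)) (mode_coef x).
Proof.
apply: finsupp_hbnd; first exact: addr_ge0.
  exact: mode_coef_out.
exact: mode_coef_norm.
Qed.

Definition mode_vec x : hscale (0 : R) := HScale (hbnd_in (@mode_coef_hbnd x)).

Lemma mode_vecB x y : mode_vec x - mode_vec y = mode_vec (x - y).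
Proof.
apply: hscale_ext => n; rewrite coefB /= /mode_coef; case: insub => [j|].
  by rewrite !mxE.
by rewrite subrr.
Qed.

Lemma mode_vec_norm x : `|mode_vec x| <= K%:R * (`|x| + `|x|).
Proof. by apply: hnorm_le; [rewrite mulr_ge0 // addr_ge0 | exact: mode_coef_hbnd]. Qed.

(** Brouwer's theorem for the coefficients of [Phi] below the cutoff. They are bounded by [B]
    because |n|^s >= 1, so no invariant set has to be constructed. *)
Lemma galerkin s B L (Phi : hscale (0 : R) -> hscale (0 : R)) : 0 <= s -> 0 <= B -> 0 <= L ->
  (forall u, hbnd s B (Phi u)) ->
  (forall u v, `|Phi u - Phi v| <= L * `|u - v|) ->
  exists u : hscale (0 : R), (forall n, n \notin modes N -> u n = 0) /\
    (forall n, n \in modes N -> Phi u n = u n).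
Proof.
move=> s0 B0 L0 PB PL.
pose f (x : 'rV[R]_(K + K)) : 'rV[R]_(K + K) :=
  row_mx (\row_j complex.Re (Phi (mode_vec x) (tnth (in_tuple (modes N)) j)))
         (\row_j complex.Im (Phi (mode_vec x) (tnth (in_tuple (modes N)) j))).
have fc : continuous f.
  move=> x; apply/(@cvgrPdist_le _ _ _ _ (nbhs_filter x)) => e e0.
  pose C := L * (K%:R * 2) + 1.
  have C0 : 0 < C by rewrite ltr_wpDl // mulr_ge0 // mulr_ge0.
  have d0 : 0 < e / C by rewrite divr_gt0.
  have : \forall y \near x, `|x - y| < e / C.
    by apply/nbhs_ballP; exists (e / C) => // y; rewrite -ball_normE.
  apply: filterS => y xy.
  have Pxy : `|Phi (mode_vec x) - Phi (mode_vec y)| <= e.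
    apply: le_trans (PL _ _) _; rewrite mode_vecB.
    apply: (@le_trans _ _ (C * `|x - y|)); last by rewrite mulrC -ler_pdivlMr // ltW.
    apply: le_trans (ler_wpM2l L0 (mode_vec_norm _)) _.
    rewrite /C mulrDl mul1r ler_wpDr // -!mulrA ler_wpM2l //.
    by rewrite ler_wpM2l // mulr_natl mulr2n.
  rewrite [leLHS]mx_normrE; apply/bigmax_leP; split=> [|[i j] _]; first exact: ltW.
  rewrite /= !mxE; case: splitP => k _; rewrite !mxE.
    rewrite -raddfB; apply: le_trans (rnormc_Re _) (le_trans _ Pxy).
    by rewrite -coefB coef_le.
  rewrite -raddfB; apply: le_trans (rnormc_Im _) (le_trans _ Pxy).
  by rewrite -coefB coef_le.
have cB u n : `|Phi u n| <= B.
  apply: le_trans (hbnd_coef n B0 (PB u)); rewrite ler_peMl //.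
  by rewrite -(powRr0 (size_of R n)) ler_powR ?size_of_ge1.
have [x fx] : exists x, f x = x.
  apply: (@brouwer _ _ f B) => // x i; rewrite mxE; case: splitP => k _; rewrite mxE.
    exact: le_trans (rnormc_Re _) (cB _ _).
  exact: le_trans (rnormc_Im _) (cB _ _).
exists (mode_vec x); split=> [n|n nN]; first exact: mode_coef_out.
have kK : (index n (modes N) < K)%N by rewrite index_mem.
pose j := Ordinal kK.
have -> : n = tnth (in_tuple (modes N)) j by rewrite (tnth_nth n) nth_index.
rewrite [RHS]mode_coef_in -[in RHS]fx row_mxEl row_mxEr !mxE.
by case: (Phi _ _).
Qed.

End Galerkin.

(** Each Galerkin solution inherits the bound in H_s, its coefficients being those of [Phi (w N)] or
    0. In the limit every fixed mode is eventually below the cutoff, where the equation holds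
    exactly. *)
Lemma schauder s B L (Phi : hscale (0 : R) -> hscale (0 : R)) : 0 < s -> 0 <= B -> 0 <= L ->
  (forall u, hbnd s B (Phi u)) ->
  (forall u v, `|Phi u - Phi v| <= L * `|u - v|) ->
  exists u : hscale (0 : R), Phi u = u.
Proof.
move=> s0 B0 L0 PB PL.
have [w Hw] := choice (fun N => galerkin N (ltW s0) B0 L0 PB PL).
have wB N : hbnd s B (w N).
  move=> r ur; apply: le_trans (PB (w N) r ur); apply: ler_sum => n _.
  have [w0 w1] := Hw N; have [/w1 -> //|/w0 ->] := boolP (n \in modes N).
  by rewrite normr0 expr0n mulr0 mulr_ge0 ?hweight_ge0 ?sqr_ge0.
have [U [UU Uoo]] := ultraFilterLemma (F := \oo) _.
have [u [_ wu]] : exists u : hscale (0 : R), hbnd s B u /\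
    forall eps : R, 0 < eps -> \forall i \near U, `|w i - u| <= eps.
  by apply: hbnd_compact => //; apply: nearW.
exists u; apply: hscale_ext => n; apply/eqP; rewrite -subr_eq0 -normr_le0.
apply/ler_addgt0Pr => e e0; rewrite add0r.
have d0 : 0 < e / (L + 1) by rewrite divr_gt0 // ltr_wpDl.
have nN : \forall N \near U, n \in modes N.
  by apply: Uoo; exists `|val n|%N => // N /= ?; rewrite mem_modes.
have [N [wN nN']] := filter_ex (filterI (wu _ d0) nN).
have -> : Phi u n - u n = (Phi u - Phi (w N)) n + (w N - u) n.
  by rewrite !coefB (proj2 (Hw N)) // addrA subrK.
apply: le_trans (ler_normD _ _) _.
apply: (@le_trans _ _ (L * `|w N - u| + `|w N - u|)).
  by apply: lerD; rewrite (le_trans (coef_le _ _)) // (distrC (w N)).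
by rewrite -[X in _ + X]mul1r -mulrDl mulrC -ler_pdivlMr // ltr_wpDl.
Qed.

End Schauder.

(** * The Euler scheme *)

Lemma is_derive1_eps (R : realType) (V : normedModType R) (f : R -> V) (t : R) (l : V) :
  (forall eps : R, 0 < eps -> exists2 delta : R, 0 < delta &
    forall s, `|s - t| < delta -> `|f s - f t - (s - t) *: l| <= eps * `|s - t|) ->
  is_derive t 1 f l.
Proof.
move=> H.
have C : (fun k : R => k^-1 *: ((f \o shift t) (k *: 1) - f t)) @ 0^' --> l.
  apply/cvgrPdist_le => e e0; have [dl d0 Hd] := H e e0.
  apply/nbhs_ballP; exists dl => //= k; rewrite /ball /= sub0r normrN => kd k0.
  rewrite scaler1 -[X in X - _](scalerK k0) -scalerBr normrZ normfV.
  rewrite ler_pdivrMl ?normr_gt0 // mulrC distrC.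
  by have := Hd (k + t); rewrite addrK; apply.
apply: DeriveDef; first by apply/cvg_ex; exists l.
rewrite /derive; apply: cvg_lim C; exact: norm_hausdorff.
Qed.

Lemma add_sub_add (V : zmodType) (x x' y y' : V) : x + x' - (y + y') = (x - y) + (x' - y').
Proof. by rewrite opprD addrACA. Qed.

Section Euler.
Variables (R : realType) (d : nat) (X T h s : R) (g : R -> hscale (0 : R) -> hscale h).
Variables (C L Cm : R) (m : nzint -> Rcomplex R).
Hypotheses (T0 : 0 < T) (h0 : 0 <= h) (s0 : 0 < s) (C0 : 0 <= C) (L0 : 0 <= L).
Hypothesis g_bound : forall t v, `|g t v| <= C.
Hypothesis g_lip : forall t v w, `|g t v - g t w| <= L * `|v - w|.
Hypothesis g_cont : forall t B (v : hscale (0 : R)), 0 <= B -> hbnd s B v -> forall eps : R, 0 < eps ->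
  exists2 delta : R, 0 < delta & forall t', `|t' - t| < delta ->
    `|emb h0 (g t' v - g t v)| <= eps.
Hypothesis g_shift : forall t v, g (t + T) v = flowA d X (- T) (g t (flowA d X T v)).
Hypothesis mC : coef_bounded h s Cm m.
Hypothesis m_inv : forall n, m n * (cis (- T * eigenA d X n) - 1) = 1.

Lemma emb_flowA t (u : hscale h) : emb h0 (flowA d X t u) = flowA d X t (emb h0 u).
Proof. by apply: hscale_ext => n; rewrite /= !mul1r. Qed.

Lemma J_flowA t (u : hscale (0 : R)) : J (flowA d X t u) = flowA d X t (J u).
Proof. by apply: hscale_ext => n; rewrite /= mulrCA. Qed.

Section Grid.
Variables (N : nat) (tau : R).
Hypothesis tauM : N.+1%:R * tau = T.

(* The scheme starts at time -(N+1)T, so that every given time is covered for large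
   N, and N+1 steps of length [tau] make one period. *)
Definition node (k : nat) : R := k%:R * tau - N.+1%:R * T.

Fixpoint euler (v0 : hscale (0 : R)) (k : nat) : hscale (0 : R) :=
  if k is k'.+1 then euler v0 k' + tau *: J (emb h0 (g (node k') (euler v0 k')))
  else v0.

Lemma tau_gt0 : 0 < tau.
Proof. by move: T0; rewrite -tauM pmulr_rgt0. Qed.

Lemma nodeD k : node (k + N.+1) = node k + T.
Proof. by rewrite /node natrD mulrDl tauM addrAC. Qed.

(** The increment is exhibited as the image of an element of H_h, the space on which the multiplier
    [m] acts. *)
Lemma euler_diff v0 k l : (k <= l)%N ->
  euler v0 l - euler v0 k =
  J (emb h0 (\sum_(k <= j < l) tau *: g (node j) (euler v0 j))).
Proof.
move=> kl; rewrite -(subnKC kl); elim: (l - k)%N => [|n IH].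
  by rewrite addn0 subrr big_geq // emb_0 J_0.
rewrite addnS big_nat_recr ?leq_addr //= emb_add J_add -IH emb_scale J_scale.
by rewrite addrAC.
Qed.

Lemma drift_norm v0 k l : (k <= l)%N ->
  `|\sum_(k <= j < l) tau *: g (node j) (euler v0 j)| <= (l - k)%:R * tau * C.
Proof.
move=> kl; apply: le_trans (ler_norm_sum _ _ _) _.
apply: (@le_trans _ _ (\sum_(k <= j < l) tau * C)).
  apply: ler_sum => j _; rewrite normrZ gtr0_norm ?tau_gt0 //.
  by rewrite ler_wpM2l ?g_bound // ltW // tau_gt0.
by rewrite sumr_const_nat -mulrA mulr_natl.
Qed.

Lemma euler_lip_time v0 k l : (k <= l)%N ->
  `|euler v0 l - euler v0 k| <= (l - k)%:R * tau * C.
Proof.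
move=> kl; rewrite euler_diff // J_norm; apply: le_trans (emb_norm _ _) _.
exact: drift_norm.
Qed.

(** The constant may grow with [k]: it serves only to make [period_map] Lipschitz for a fixed step
    size. *)
Lemma euler_lip k : exists2 A, 0 <= A &
  forall v w, `|euler v k - euler w k| <= A * `|v - w|.
Proof.
have tau0 := ltW tau_gt0.
elim: k => [|k [A A0 IH]]; first by exists 1 => // v w; rewrite mul1r.
exists (A + tau * (L * A)); first by rewrite addr_ge0 // mulr_ge0 // mulr_ge0.
move=> v w /=; rewrite (add_sub_add (euler v k)) -scalerBr -J_sub -emb_sub.
apply: le_trans (ler_normD _ _) _; rewrite mulrDl lerD // normrZ ger0_norm //.
rewrite -mulrA ler_wpM2l // J_norm; apply: le_trans (emb_norm _ _) _.
by apply: le_trans (g_lip _ _ _) _; rewrite -mulrA ler_wpM2l.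
Qed.

(* Multiplication by [m] inverts exp(-TJA) - 1, so a fixed point is an initial value
   whose Euler polygon closes up in the rotating frame. *)
Definition period_map (v : hscale (0 : R)) : hscale (0 : R) :=
  emb (ltW s0) (mult mC (J (\sum_(0 <= j < N.+1) tau *: g (node j) (euler v j)))).

(** One period of drift has norm at most T C in H_h, whatever the step size and the state. This
    uniformity feeds both Schauder's theorem and the limit of small steps. *)
Lemma mult_period_hbnd v k :
  hbnd s (Cm * (T * C)) (mult mC (J (\sum_(k <= j < k + N.+1) tau *: g (node j) (euler v j)))).
Proof.
apply: (hbndW (normr_ge0 _) _ (hnorm_hbnd (mult mC _))).
apply: le_trans (mult_norm _ _) _; apply: ler_wpM2l; first by case: mC.
rewrite J_norm; apply: le_trans (drift_norm _ (leq_addr _ _)) _.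
by rewrite addKn tauM.
Qed.

Lemma euler_closed : exists v, euler v N.+1 = flowA d X (- T) v.
Proof.
have B0 : 0 <= Cm * (T * C) by rewrite !mulr_ge0 // ?(ltW T0) //; case: mC.
have Pb v : hbnd s (Cm * (T * C)) (period_map v).
  move=> r ur; apply: le_trans (@mult_period_hbnd v 0 r ur).
  by apply: ler_sum => n _; rewrite embE.
have [A A0 PL] : exists2 A, 0 <= A & forall v w, `|period_map v - period_map w| <= A * `|v - w|.
  have K k : exists2 A, 0 <= A & forall v w,
    `|\sum_(0 <= j < k) tau *: g (node j) (euler v j) -
      \sum_(0 <= j < k) tau *: g (node j) (euler w j)| <= A * `|v - w|.
    elim: k => [|k [A A0 IH]].
      by exists 0 => // v w; rewrite !big_geq // subrr normr0 mul0r.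
    have [A' A'0 HA'] := euler_lip k; have tau0 := ltW tau_gt0.
    exists (A + tau * (L * A')); first by rewrite addr_ge0 // mulr_ge0 // mulr_ge0.
    move=> v w; rewrite !big_nat_recr //=.
    rewrite (add_sub_add (\sum_(0 <= j < k) tau *: g (node j) (euler v j))) -scalerBr.
    apply: le_trans (ler_normD _ _) _; rewrite mulrDl lerD // normrZ ger0_norm //.
    by rewrite -mulrA ler_wpM2l // (le_trans (g_lip _ _ _)) // -mulrA ler_wpM2l.
  have [A A0 HA] := K N.+1; have Cm0 : 0 <= Cm by case: mC.
  exists (Cm * A); first exact: mulr_ge0.
  move=> v w; rewrite /period_map -emb_sub -mult_sub -J_sub.
  apply: le_trans (emb_norm _ _) _; apply: le_trans (mult_norm _ _) _.
  by rewrite J_norm -mulrA ler_wpM2l.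
have [v Pv] := schauder s0 B0 A0 Pb PL.
exists v; apply/eqP; rewrite -subr_eq0; apply/eqP.
have E : euler v N.+1 - v = emb h0 (J (\sum_(0 <= j < N.+1) tau *: g (node j) (euler v j))).
  rewrite -[X in _ - X]/(euler v 0) euler_diff //.
  by apply: hscale_ext => n; rewrite /= !mul1r.
apply: hscale_ext => n.
have En := congr1 (fun u : hscale (0 : R) => u n) E; rewrite coefB embE in En.
have := congr1 (fun u : hscale (0 : R) => u n) Pv; rewrite /period_map embE.
rewrite -[(mult mC _ : nzint -> Rcomplex R) n]/(m n * _) -En => Vn.
rewrite coefB -[flowA _ _ _ _ n]/(cis _ * v n).
have : (cis (- T * eigenA d X n) - 1) * (m n * (euler v N.+1 n - v n)) =
       (cis (- T * eigenA d X n) - 1) * v n by rewrite Vn.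
rewrite mulrA [_ * m n]mulrC m_inv mul1r mulrBl mul1r => Z.
by rewrite -[euler v _ n](subrK (v n)) Z subrK subrr.
Qed.

Section Closed.
Variable v0 : hscale (0 : R).
Hypothesis v0P : euler v0 N.+1 = flowA d X (- T) v0.

Lemma euler_shift k : euler v0 (k + N.+1) = flowA d X (- T) (euler v0 k).
Proof.
elim: k => [|k IH]; first by rewrite add0n.
rewrite addSn /= IH nodeD g_shift flowANK emb_flowA J_flowA.
by rewrite flowA_add flowA_scale.
Qed.

(** By [euler_shift] the increment over the period starting at node [k] is exp(-TJA) - 1 applied to
    that node. So every node is [m] applied to one period of drift, and no growth in [k] arises. *)
Lemma euler_hbnd k : hbnd s (Cm * (T * C)) (euler v0 k).
Proof.
move=> r ur; apply: le_trans (@mult_period_hbnd v0 k r ur).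
apply: ler_sum => n _; set w := \sum_(k <= j < _) _.
rewrite (_ : mult mC (J w) n = euler v0 k n) //.
have := euler_diff v0 (leq_addr N.+1 k); rewrite euler_shift -/w => E.
have := congr1 (fun u : hscale (0 : R) => u n) E.
rewrite coefB -[flowA _ _ _ _ n]/(cis _ * euler v0 k n).
rewrite -[(J (emb h0 w)) n]/('i%C * (1 * w n)) mul1r => E'.
rewrite -[mult _ _ n]/(m n * ('i%C * w n)) -E'.
by rewrite -[X in _ - X]mul1r -mulrBl mulrA m_inv mul1r.
Qed.

Definition index_at (t : R) : nat := Num.truncn ((t + N.+1%:R * T) / tau).

Lemma index_atP t : - (N.+1%:R * T) <= t ->
  node (index_at t) <= t /\ t < node (index_at t) + tau.
Proof.
move=> tN; have tau0 := tau_gt0.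
have /truncn_itv/andP[] : 0 <= (t + N.+1%:R * T) / tau.
  by apply: divr_ge0; [lra | exact: ltW].
rewrite -/(index_at t) ler_pdivlMr // ltr_pdivrMr // -natr1 mulrDl mul1r /node.
by move=> ? ?; split; lra.
Qed.

Lemma index_at_le a b : - (N.+1%:R * T) <= a -> a <= b -> (index_at a <= index_at b)%N.
Proof.
move=> aN ab; have tau0 := tau_gt0; apply: le_truncn.
by rewrite ler_pM2r ?invr_gt0 // lerD2r.
Qed.

Lemma index_at_shift t : - (N.+1%:R * T) <= t ->
  index_at (t + T) = (index_at t + N.+1)%N.
Proof.
move=> tN; have tau0 := tau_gt0; have [i1 i2] := index_atP tN.
apply: truncn_def; rewrite ler_pdivlMr // ltr_pdivrMr //.
move: i1 i2; rewrite /node -[(index_at t + _).+1%:R]natr1 natrD !mulrDl tauM mul1r; lra.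
Qed.

(** A step function instead of the polygon: it inherits the bound and the twisted periodicity of the
    nodes directly, and its jumps vanish with the step size. *)
Definition euler_path (t : R) : hscale (0 : R) := euler v0 (index_at t).

Lemma euler_path_shift t : - (N.+1%:R * T) <= t -> euler_path (t + T) = flowA d X (- T) (euler_path t).
Proof. by move=> tN; rewrite /euler_path index_at_shift // euler_shift. Qed.

(** One [eps] pays for replacing the state by [u], the other for replacing the time by [t]. The
    steps between [a] and [b] have total length within [tau] of [b - a], whence the terms in [tau];
    the first node may precede [a] by up to [tau]. *)
Lemma euler_path_slope a b t (u : hscale (0 : R)) eps :
  0 <= eps -> - (N.+1%:R * T) <= a -> a <= b ->
  (forall t', a - tau <= t' <= b -> `|emb h0 (g t' u - g t u)| <= eps) ->
  (forall k, (index_at a <= k < index_at b)%N -> `|euler v0 k - u| * L <= eps) ->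
  `|euler_path b - euler_path a - (b - a) *: J (emb h0 (g t u))| <=
    2 * eps * (b - a + tau) + tau * `|g t u|.
Proof.
move=> e0 aN ab Hc Hl; have tau0 := tau_gt0.
have kl := index_at_le aN ab; have [ka ka'] := index_atP aN.
have [kb kb'] := index_atP (le_trans aN ab).
set k := index_at a in kl ka ka' Hl *; set l := index_at b in kl kb kb' Hl *.
have lkE : (l - k)%:R * tau = node l - node k :> R.
  by rewrite /node natrB //; ring.
rewrite -[euler_path b]/(euler v0 l) -[euler_path a]/(euler v0 k) euler_diff //.
rewrite -J_scale -emb_scale -J_sub -emb_sub J_norm.
set G := g t u.
rewrite (_ : \sum_(k <= j < l) _ - _ =
   \sum_(k <= j < l) tau *: (g (node j) (euler v0 j) - G) +
   ((l - k)%:R * tau - (b - a)) *: G); last first.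
  under [X in _ = X + _]eq_bigr do rewrite scalerBr.
  rewrite big_split /= sumrN sumr_const_nat -scaler_nat scalerA [X in _ = _ + X]scalerBl.
  by rewrite addrA subrK.
rewrite emb_add; apply: le_trans (ler_normD _ _) _; apply: lerD; last first.
  apply: le_trans (emb_norm _ _) _; rewrite normrZ ler_wpM2r // lkE.
  by rewrite ler_norml; apply/andP; split; lra.
rewrite emb_sum; apply: le_trans (ler_norm_sum _ _ _) _.
apply: (@le_trans _ _ (\sum_(k <= j < l) tau * (2 * eps))).
  rewrite big_nat [leRHS]big_nat; apply: ler_sum => j kjl.
  rewrite emb_scale normrZ gtr0_norm // ler_pM2l //.
  rewrite (_ : g _ _ - G = (g (node j) (euler v0 j) - g (node j) u) + (g (node j) u - G)); last first.
    by rewrite addrA subrK.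
  rewrite emb_add; apply: le_trans (ler_normD _ _) _; rewrite mulr2n mulrDl mul1r; apply: lerD.
    apply: le_trans (emb_norm _ _) _; apply: le_trans (g_lip _ _ _) _.
    by rewrite mulrC Hl.
  apply: Hc; apply/andP; move/andP: kjl => [kj jl].
  have n1 : node k <= node j by rewrite /node lerD2r ler_pM2r // ler_nat.
  have n2 : node j <= node l by rewrite /node lerD2r ler_pM2r // ler_nat ltnW.
  by split; lra.
rewrite sumr_const_nat -[leLHS]mulr_natl [leLHS]mulrA lkE mulrC.
by rewrite ler_wpM2l ?mulr_ge0 //; lra.
Qed.

End Closed.
End Grid.

Lemma le_of_small (x y K e : R) : 0 <= K -> 0 < e ->
  (forall eta, 0 < eta -> eta < e -> x <= y + eta * K) -> x <= y.
Proof.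
move=> K0 e0 H; apply/ler_addgt0Pr => c c0.
have K1 : 0 < K + 1 by rewrite ltr_wpDl.
pose eta := Num.min (e / 2) (c / (K + 1)).
have eta0 : 0 < eta by rewrite lt_min !divr_gt0.
have etae : eta < e by rewrite gt_min; apply/orP; left; rewrite ltr_pdivrMr // ltr_pMr // ltr1n.
apply: le_trans (H eta eta0 etae) _; rewrite lerD2l.
have : eta * (K + 1) <= c by rewrite -ler_pdivlMr // ge_min lexx orbT.
by rewrite mulrDr mulr1; lra.
Qed.

(** The derivative at [t] only requires the slope estimate between [t] and one other time, so
    convergence at each time separately suffices. *)
Lemma periodic_solution : exists v : R -> hscale (0 : R),
  [/\ forall t, hbnd s (Cm * (T * C)) (v t), forall t, v (t + T) = flowA d X (- T) (v t) &
    forall t : R, is_derive t 1 v (J (emb h0 (g t (v t))))].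
Proof.
have B0 : 0 <= Cm * (T * C) by rewrite !mulr_ge0 // ?(ltW T0) //; case: mC.
have [tau tauM] : exists tau : nat -> R, forall N, N.+1%:R * tau N = T.
  by exists (fun N => T / N.+1%:R) => N; rewrite mulrC divfK // pnatr_eq0.
have [v0 Hv0] := choice (fun N => euler_closed (tauM N)).
pose V N t := euler_path N (tau N) (v0 N) t.
have [U [UU Uoo]] := ultraFilterLemma (F := \oo) _.
have VB N t : hbnd s (Cm * (T * C)) (V N t) by exact: euler_hbnd.
have [v Hv] : exists v : R -> hscale (0 : R), forall t, hbnd s (Cm * (T * C)) (v t) /\
    forall eps : R, 0 < eps -> \forall N \near U, `|V N t - v t| <= eps.
  have K t : exists u : hscale (0 : R), hbnd s (Cm * (T * C)) u /\
      forall eps : R, 0 < eps -> \forall N \near U, `|V N t - u| <= eps.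
    by apply: hbnd_compact => //; apply: nearW.
  by have [v Hv] := choice K; exists v.
have Ustart a : \forall N \near U, - (N.+1%:R * T) <= a.
  apply: Uoo; near=> N.
  have : - a / T < N%:R by near: N; exact: nbhs_infty_gtr.
  by rewrite ltr_pdivrMr // -natr1 mulrDl => ?; move: T0; lra.
have Utau eta : 0 < eta -> \forall N \near U, tau N <= eta.
  move=> eta0; apply: Uoo; near=> N.
  have : T / eta < N%:R by near: N; exact: nbhs_infty_gtr.
  rewrite ltr_pdivrMr // -(ler_pM2l (ltr0Sn R N)) tauM -natr1 mulrDl mul1r.
  by move=> ?; lra.
exists v; split=> [t|t|t]; first by case: (Hv t).
  apply/eqP; rewrite -subr_eq0 -normr_le0; apply/ler_addgt0Pr => e e0.
  have e2 : 0 < e / 2 by rewrite divr_gt0.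
  have [N [[h1 h2] h3]] := filter_ex
    (filterI (filterI ((Hv (t + T)).2 _ e2) ((Hv t).2 _ e2)) (Ustart t)).
  rewrite add0r (splitr e); apply: le_trans (ler_distD (V N (t + T)) _ _) _.
  rewrite distrC; apply: lerD => //.
  by rewrite /V (euler_path_shift (tauM N)) // -flowA_sub flowA_norm.
apply: is_derive1_eps => eps eps0; set G := J _.
have e10 : 0 < eps / 2 by rewrite divr_gt0.
have [dl1 d10 Hd1] := @g_cont t _ (v t) B0 (Hv t).1 _ e10.
pose Q := L * C + L + 1.
have LC0 : 0 <= L * C by rewrite mulr_ge0.
have Q0 : 0 < Q by rewrite ltr_wpDl // addr_ge0.
(* With this choice L (2 rho C + rho) <= 3 rho Q = eps / 2, where 2 rho C + rho will bound the
   distance of the nodes from [v t]. *)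
pose rho := eps / 2 / (3 * Q).
have rho0 : 0 < rho by rewrite divr_gt0 // mulr_gt0.
pose dl := Num.min rho (dl1 / 2).
have dl0 : 0 < dl by rewrite lt_min rho0 divr_gt0.
have dlr : dl <= rho by rewrite ge_min lexx.
have dl2 : dl <= dl1 / 2 by rewrite ge_min lexx orbT.
(* Allowing [t] to be either end of the interval covers both one-sided slopes. *)
have key a b : a <= b -> b - a < dl -> (t = a \/ t = b) ->
    `|v b - v a - (b - a) *: G| <= eps * (b - a).
  move=> ab abd tab.
  have ba0 : 0 <= b - a by rewrite subr_ge0.
  (* The 2 accounts for replacing the approximation by [v] at [a] and at [b]; the other summands
     come from the terms in the step size. *)
  apply: (@le_of_small _ _ (2 + eps + `|g t (v t)|) dl) => //.
    by rewrite addr_ge0 // addr_ge0 // ltW.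
  move=> eta eta0 etad.
  have [N [[h1 h2] [h3 h4]]] := filter_ex (filterI
    (filterI ((Hv a).2 _ eta0) ((Hv b).2 _ eta0)) (filterI (Ustart a) (Utau _ eta0))).
  have tau0 := tau_gt0 (tauM N).
  have bN := le_trans h3 ab.
  have iab := index_at_le (tauM N) h3 ab.
  have tN : - (N.+1%:R * T) <= t by case: tab => ->.
  have Vt : `|V N t - v t| <= eta by case: tab => ->.
  have := @euler_path_slope N (tau N) (tauM N) (v0 N) a b t (v t) (eps / 2) (ltW e10) h3 ab.
  have H1 t' : a - tau N <= t' <= b -> `|emb h0 (g t' (v t) - g t (v t))| <= eps / 2.
    move=> /andP[t1 t2]; apply: Hd1; rewrite ltr_norml.
    by apply/andP; split; case: tab => ->; lra.
  have H2 k : (index_at N (tau N) a <= k < index_at N (tau N) b)%N ->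
      `|euler N (tau N) (v0 N) k - v t| * L <= eps / 2.
    move=> /andP[ka kb].
    have [a1 a2] := index_atP (tauM N) h3; have [b1 b2] := index_atP (tauM N) bN.
    have D : (index_at N (tau N) b - index_at N (tau N) a)%:R * tau N <= b - a + tau N.
      rewrite natrB // mulrBl; move: a1 a2 b1 b2; rewrite /node; lra.
    have E : `|euler N (tau N) (v0 N) k - V N t| <= (b - a + tau N) * C.
      apply: le_trans (ler_wpM2r C0 D); rewrite /V /euler_path; case: tab => ->.
        apply: le_trans (euler_lip_time (tauM N) _ ka) _.
        by rewrite -!mulrA ler_wpM2r ?mulr_ge0 ?(ltW tau0) // ler_nat leq_sub2r // ltnW.
      rewrite distrC; apply: le_trans (euler_lip_time (tauM N) _ (ltnW kb)) _.
      by rewrite -!mulrA ler_wpM2r ?mulr_ge0 ?(ltW tau0) // ler_nat leq_sub2l.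
    have F : `|euler N (tau N) (v0 N) k - v t| <= 2 * rho * C + rho.
      rewrite -(subrK (V N t) (euler _ _ _ _)) -addrA.
      apply: le_trans (ler_normD _ _) _; apply: lerD; last by lra.
      by apply: le_trans E _; rewrite ler_wpM2r //; lra.
    apply: le_trans (ler_wpM2r L0 F) _.
    have -> : eps / 2 = rho * (3 * Q) by rewrite /rho divfK // gt_eqF // mulr_gt0.
    rewrite /Q; have := mulr_ge0 (ltW rho0) LC0; have := mulr_ge0 (ltW rho0) L0; lra.
  move=> /(_ H1 H2); rewrite -/(V N a) -/(V N b) -/G => P.
  rewrite (_ : v b - v a - _ = (V N b - V N a - (b - a) *: G) + (V N a - v a) - (V N b - v b)); last first.
    move: ((b - a) *: G) => W.
    by apply: hscale_ext => n; rewrite !(coefB, coefD, coefN); ring.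
  apply: le_trans (ler_normB _ _) _; apply: le_trans (lerD (ler_normD _ _) (lexx _)) _.
  have T1 : tau N * `|g t (v t)| <= eta * `|g t (v t)| by rewrite ler_wpM2r.
  have T2 : eps * (b - a + tau N) <= eps * (b - a + eta) by rewrite ler_wpM2l ?(ltW eps0) // lerD2l.
  move: P; rewrite (_ : 2 * (eps / 2) = eps); last by field.
  by rewrite mulrDr in T2; move=> P; nra.
exists dl => // r rt; have [tr|/ltW rt'] := leP t r.
  by rewrite ger0_norm ?subr_ge0 // in rt *; apply: key => //; left.
rewrite ler0_norm ?subr_le0 // opprB in rt *.
rewrite -normrN (_ : - _ = v t - v r - (t - r) *: G); first by apply: key => //; right.
rewrite -[t - r]opprB scaleNr; move: ((r - t) *: G) => W.
by apply: hscale_ext => n; rewrite !(coefB, coefN); ring.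
Unshelve. all: by end_near. Qed.

End Euler.

(** * Small divisors *)

Section SmallDivisors.
Variable R : realType.

Lemma cos_ge_half (w : R) : 0 <= w <= pi / 4 -> 2^-1 <= cos w.
Proof.
move=> /andP[w0 w1]; have p0 := pi_gt0 R.
have c0 : 0 <= cos w by apply: cos_ge0_pihalf; apply/andP; split; lra.
have : 0 <= cos (w *+ 2).
  by apply: cos_ge0_pihalf; rewrite [w *+ 2]mulr2n; apply/andP; split; lra.
rewrite cos_mulr2n [_ *+ 2]mulr2n => H; rewrite leNgt; apply/negP => cw.
by nra.
Qed.

(** With w = z / 2, sin z = 2 sin w cos w and sin w = w cos c for some c < w; both cosines are at
    least 1/2. *)
Lemma sin_ge_quarter (z : R) : 0 <= z <= pi / 2 -> z / 4 <= sin z.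
Proof.
move=> /andP[z0 z1]; have p0 := pi_gt0 R.
have [->|zN0] := eqVneq z 0; first by rewrite mul0r sin0.
pose w := z / 2; have zE : z = w *+ 2 by rewrite /w -mulr_natr divfK.
have w0 : 0 < w by rewrite divr_gt0 // lt_def zN0.
have w1 : w <= pi / 4 by rewrite /w; lra.
have [c /[!in_itv]/= /andP[c0 c1] cE] := @MVT R sin cos 0 w w0
  (fun x _ => is_derive_sin x) (continuous_subspaceT (@continuous_sin R)).
rewrite zE sin_mulr2n mulr2n; move: cE; rewrite sin0 !subr0 => ->.
have h1 : 2^-1 <= cos c by apply: cos_ge_half; apply/andP; split; lra.
have h2 : 2^-1 <= cos w by apply: cos_ge_half; apply/andP; split; lra.
have h3 : w / 2 <= cos c * w by rewrite mulrC ler_pM2r.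
have h4 : 2^-1 * (w / 2) <= cos w * (cos c * w) by apply: ler_pM => //; lra.
by rewrite mulr2n; lra.
Qed.

Lemma cisN (x : R) : cis (- x) * cis x = 1.
Proof. by rewrite -cisD addNr cis0. Qed.

Lemma cis_2pi_int (k : int) : cis (2 * pi * k%:~R) = 1 :> Rcomplex R.
Proof.
have nat_case n : cis (2 * pi * n%:R) = 1 :> Rcomplex R.
  elim: n => [|n IH]; first by rewrite mulr0 cis0.
  rewrite -[n.+1%:R]natr1 mulrDr mulr1 cisD IH mul1r /cis mulrC mulr_natr.
  by rewrite cos2pi sin2pi.
case: k => n; first exact: nat_case.
rewrite NegzE mulrNz mulrN; have := cisN (2 * pi * n.+1%:R).
by rewrite nat_case mulr1.
Qed.

(** [p] is the nearest integer. With y = x - p the chord has length 2 |sin (pi y)| >= pi |y| / 2 >=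
    |y|. *)
Lemma cis_sub1_ge (x : R) : exists p : int, `|x - p%:~R| <= `|(cis (2 * pi * x) - 1 : Rcomplex R)|.
Proof.
pose p := Num.floor (x + 2^-1); exists p.
have /andP[p1 p2] := floor_itv (x + 2^-1).
rewrite -/p intrD in p1 p2.
have y2 : `|x - p%:~R| <= 2^-1 by rewrite ler_norml; apply/andP; split; lra.
rewrite -[X in cis (2 * pi * X)](subrK p%:~R x) mulrDr cisD cis_2pi_int mulr1.
move: (x - _) y2 => y y2.
rewrite -(ler_pXn2r (n := 2)) ?nnegrE ?normr_ge0 // rnormc_sqr /=.
rewrite (_ : 2 * pi * y = (pi * y) *+ 2); last by rewrite mulr2n; ring.
rewrite oppr0 addr0 cos_mulr2n sin_mulr2n.
have p0 := pi_ge2 R.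
have S : `|y| / 2 <= `|sin (pi * y)|.
  have : pi * `|y| / 4 <= sin (pi * `|y|).
    apply: sin_ge_quarter; apply/andP; split; first by rewrite mulr_ge0 // ltW // pi_gt0.
    by rewrite ler_pM2l ?pi_gt0.
  have -> : `|sin (pi * y)| = `|sin (pi * `|y|)|.
    by case: (leP 0 y) => y0; [rewrite (ger0_norm y0)|rewrite (ltr0_norm y0) mulrN sinN normrN].
  move=> H; apply: le_trans (ler_norm _); apply: le_trans H.
  by have := normr_ge0 y; nra.
have {}S : (`|y| / 2) ^+ 2 <= `|sin (pi * y)| ^+ 2.
  by rewrite ler_pXn2r ?nnegrE ?divr_ge0 ?normr_ge0.
have E := cos2Dsin2 (pi * y); move: S E.
rewrite exprMn !real_normK ?num_real // exprVn -[cos _ ^+ 2 *+ 2]mulr_natr -[cos _ * sin _ *+ 2]mulr_natr.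
move: (sin _) (cos _) => a b S E.
have -> : (b ^+ 2 * 2 - 1 - 1) ^+ 2 + (b * a * 2) ^+ 2 = 4 * a ^+ 2.
  rewrite (_ : b ^+ 2 * 2 - 1 - 1 = - 2 * a ^+ 2); last by lra.
  rewrite (_ : (b * a * 2) ^+ 2 = 4 * a ^+ 2 * b ^+ 2); last by ring.
  by rewrite (_ : b ^+ 2 = 1 - a ^+ 2); [ring | lra].
by lra.
Qed.

(** For negative rho the bound c q^(- rho) reaches 1 for large q, while floor (x q) / q lies within
    1 of x. Hence the infimum in [irr_measure] is over a set bounded below. *)
Lemma irr_exponents_ge0 (x rho : R) : irr_exponents x rho -> 0 <= rho.
Proof.
move=> [c c0 H]; rewrite leNgt; apply/negP => r0.
have r1 : 0 < - rho by rewrite oppr_gt0.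
pose q := (Num.truncn (c^-1 `^ (- rho)^-1)).+1.
have q0 : 0 < q%:R :> R by rewrite ltr0n.
pose p := Num.floor (x * q%:R).
have := H p q isT; apply/negP; rewrite -leNgt.
apply: (@le_trans _ _ 1).
  have -> : x - p%:~R / q%:R = (x * q%:R - p%:~R) / q%:R by field; rewrite gt_eqF.
  have /andP[p1 p2] := floor_itv (x * q%:R); rewrite -/p intrD in p1 p2.
  rewrite normrM normfV (gtr0_norm q0) ler_pdivrMr // mul1r.
  apply: (@le_trans _ _ 1); last by rewrite ler1n.
  by rewrite ler_norml; apply/andP; split; lra.
rewrite mulrC -ler_pdivrMr // mul1r.
have -> : c^-1 = (c^-1 `^ (- rho)^-1) `^ (- rho).
  by rewrite -powRrM mulVf ?gt_eqF // powRr1 // ltW // invr_gt0.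
apply: ge0_ler_powR; rewrite ?nnegrE ?powR_ge0 ?(ltW r1) ?(ltW q0) //.
exact/ltW/truncnS_gt.
Qed.

Lemma irr_measure_approx (x eps : R) : diophantine x -> 0 < eps ->
  exists2 rho, irr_exponents x rho & rho < irr_measure x + eps.
Proof.
move=> [_ ne] e0; apply: inf_adherent => //; split=> //.
by exists 0 => rho; exact: irr_exponents_ge0.
Qed.

(** Here - T a n^d = - 2 pi sigma n^d with sigma the rotation number. Up to sign n^d is q = |n|^d,
    taken as denominator: the distance of sigma n^d to an integer is q |sigma - p/q| for some p,
    which exceeds c q^(1 - rho). *)
Lemma small_divisor (d : nat) (T X rho : R) :
  irr_exponents (rotnum d T X) rho ->
  exists2 c : R, 0 < c & forall n : nzint,
    c * size_of R n `^ (- (d%:R * (rho - 1))) <=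
      `|(cis (- T * eigenA d X n) - 1 : Rcomplex R)|.
Proof.
move=> [c c0 H]; exists c => // n.
set sg := rotnum d T X in H.
pose q := (`|val n| ^ d)%N; pose e : int := (-1) ^+ (val n < 0)%R ^+ d.
have q0 : (0 < q)%N by rewrite expn_gt0 absz_gt0 (valP n).
have q0R : 0 < q%:R :> R by rewrite ltr0n.
have ee : e * e = 1 by rewrite /e -exprMn -expr2 sqrr_sign expr1n.
have nE : (val n)%:~R ^+ d = e%:~R * q%:R :> R.
  rewrite /e /q natrX [(_ ^+ d)%:~R]rmorphXn -exprMn /=; congr (_ ^+ d).
  by rewrite {1}(intEsign (val n)) intrM.
have -> : - T * eigenA d X n = 2 * pi * - (sg * (e%:~R * q%:R)).
  rewrite /eigenA nE /sg /rotnum; move: (freq d X) => f.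
  have : 2 * pi != 0 :> R by rewrite gt_eqF // mulr_gt0 // pi_gt0.
  by move: (2 * pi) => P P0; field.
have [p Hp] := cis_sub1_ge (- (sg * (e%:~R * q%:R))).
apply: le_trans Hp; have := H (- e * p) q q0.
have eR : e%:~R * e%:~R = 1 :> R by rewrite -intrM ee.
have -> : `|- (sg * (e%:~R * q%:R)) - p%:~R| = q%:R * `|sg - (- e * p)%:~R / q%:R|.
  have -> : `|- (sg * (e%:~R * q%:R)) - p%:~R| = `|e%:~R * (- (sg * (e%:~R * q%:R)) - p%:~R)|.
    rewrite normrM (_ : `|e%:~R : R| = 1) ?mul1r //.
    by rewrite /e -exprM rmorphXn /= rmorphN1 normrX normrN1 expr1n.
  rewrite -[X in X * `|_|](gtr0_norm q0R) -normrM -normrN; congr `|_|.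
  rewrite intrM intrN.
  rewrite (_ : e%:~R * _ = - (e%:~R * e%:~R) * sg * q%:R - e%:~R * p%:~R); last by ring.
  by rewrite eR; field; rewrite gt_eqF.
move=> /ltW HH; apply: le_trans (ler_wpM2l (ltW q0R) HH).
have -> : size_of R n `^ (- (d%:R * (rho - 1))) = q%:R * q%:R `^ (- rho).
  have -> : q%:R = size_of R n `^ d%:R by rewrite powR_mulrn ?natrX // ltW // size_of_gt0.
  rewrite -powRrM -powRD; first by congr (_ `^ _); ring.
  by rewrite (gt_eqF (size_of_gt0 R n)) implybT.
by rewrite mulrCA.
Qed.

Lemma small_divisor_mult (d : nat) (T X rho h : R) :
  irr_exponents (rotnum d T X) rho ->
  exists (Cm : R) (m : nzint -> Rcomplex R),
    coef_bounded h (h - d%:R * (rho - 1)) Cm m /\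
    forall n, m n * (cis (- T * eigenA d X n) - 1) = 1.
Proof.
move=> irr; have [c c0 Hc] := small_divisor irr.
exists c^-1, (fun n => (cis (- T * eigenA d X n) - 1)^-1).
have N0 n : 0 < `|(cis (- T * eigenA d X n) - 1 : Rcomplex R)|.
  apply: lt_le_trans (Hc n); rewrite mulr_gt0 // powR_gt0 // size_of_gt0 //.
split=> [|n]; last first.
  rewrite mulVf //; apply/eqP => E; have := N0 n.
  by rewrite E (_ : `|_| = 0) ?ltxx //; exact: Normc.normc0.
split=> [|n]; first by rewrite invr_ge0 ltW.
rewrite (_ : `|_| = `|(cis (- T * eigenA d X n) - 1 : Rcomplex R)|^-1); last exact: Normc.normcV.
rewrite opprD opprK addrA subrr add0r -lef_pV2 ?posrE ?invr_gt0 ?mulr_gt0 ?powR_gt0 ?size_of_gt0 //.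
by rewrite invfM !invrK -powRN.
by rewrite invr_gt0.
Qed.

End SmallDivisors.

(** * The pairing and gradients *)

Section Pairing.
Variable R : realType.

Lemma mem_modes_large (r : seq nzint) :
  exists N0, forall N, (N0 <= N)%N -> {subset r <= modes N}.
Proof.
elim: r => [|n r [N0 H]]; first by exists 0%N.
exists (maxn N0 `|val n|) => N; rewrite geq_max => /andP[NN nN] k.
by rewrite inE => /predU1P[->|]; [rewrite mem_modes | exact: H].
Qed.

Section NonnegSum.
Variables (y : nzint -> R) (B : R).
Hypotheses (y0 : forall n, 0 <= y n).
Hypothesis yB : forall r, uniq r -> \sum_(n <- r) y n <= B.

Lemma esum_fin_num : (\esum_(n in [set: nzint]) (y n)%:E \is a fin_num)%E.
Proof.
rewrite ge0_fin_numE; last by apply: esum_ge0 => n _; rewrite lee_fin.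
apply: (@le_lt_trans _ _ B%:E); last exact: ltry.
apply: ge_ereal_sup => _ [A [finA _] <-].
by rewrite fsbig_finite //= sumEFin lee_fin; apply: yB; exact: finmap.fset_uniq.
Qed.

Lemma sum_le_esum (r : seq nzint) : uniq r ->
  \sum_(n <- r) y n <= fine (\esum_(n in [set: nzint]) (y n)%:E)%E.
Proof.
move=> ur; rewrite -lee_fin fineK; last exact: esum_fin_num.
apply: esum_ge; exists [set` r]; first by split => //; exact: finite_seq.
rewrite fsbig_finite ?finite_seq //= sumEFin lee_fin.
rewrite (perm_big (finmap.enum_fset (fset_set [set` r]))) //=.
rewrite uniq_perm ?finmap.fset_uniq // => n.
by apply/idP/idP; rewrite in_fset_set ?finite_seq //= in_setE.
Qed.

Lemma sum_modes_cvg : \sum_(n <- modes N) y n @[N --> \oo] -->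
  fine (\esum_(n in [set: nzint]) (y n)%:E)%E.
Proof.
set S := fine _; apply/cvgrPdist_le => e e0.
have [r [ur Hr]] : exists r, uniq r /\ S - e <= \sum_(n <- r) y n.
  apply/not_existsP => H.
  have : S <= S - e.
    rewrite -lee_fin fineK; last exact: esum_fin_num.
    apply: ge_ereal_sup => _ [A [finA _] <-].
    rewrite fsbig_finite //= sumEFin lee_fin leNgt; apply/negP => /ltW L.
    by apply: (H (finmap.enum_fset (fset_set A))); split=> //; exact: finmap.fset_uniq.
  by lra.
have [N0 HN0] := mem_modes_large r.
exists N0 => // N /= NN; rewrite ler_norml; apply/andP; split.
  by have := sum_le_esum (modes_uniq N); rewrite -/S; lra.
suff : \sum_(n <- r) y n <= \sum_(n <- modes N) y n by lra.
rewrite [leRHS](bigID (mem r)) /= -[X in _ <= X + _]big_filter.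
have P : perm_eq r [seq n <- modes N | n \in r].
  apply: uniq_perm => //; first exact: filter_uniq (modes_uniq N).
  move=> n; rewrite mem_filter; case: (boolP (n \in r)) => // nr.
  by rewrite (HN0 N NN n nr).
by rewrite (perm_big _ P) lerDl sumr_ge0.
Qed.

End NonnegSum.

(** Absolute summability makes the sums of both parts finite, so [rsum] is not junk. The algebra of
    the pairing then follows by uniqueness of limits. *)
Lemma rsum_cvg (x : nzint -> R) (B : R) :
  (forall r, uniq r -> \sum_(n <- r) `|x n| <= B) ->
  \sum_(n <- modes N) x n @[N --> \oo] --> rsum x.
Proof.
move=> xB.
pose xp n := Num.max (x n) 0; pose xm n := Num.max (- x n) 0.
have xp0 n : 0 <= xp n by rewrite le_max lexx orbT.
have xm0 n : 0 <= xm n by rewrite le_max lexx orbT.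
have xpB r : uniq r -> \sum_(n <- r) xp n <= B.
  move=> ur; apply: le_trans (xB r ur); apply: ler_sum => n _.
  by rewrite ge_max ler_norm normr_ge0.
have xmB r : uniq r -> \sum_(n <- r) xm n <= B.
  move=> ur; apply: le_trans (xB r ur); apply: ler_sum => n _.
  by rewrite ge_max normr_ge0 andbT -normrN ler_norm.
have -> : rsum x = fine (\esum_(n in [set: nzint]) (xp n)%:E)%E -
    fine (\esum_(n in [set: nzint]) (xm n)%:E)%E.
  rewrite -fineB; [|exact: (esum_fin_num xp0 xpB)|exact: (esum_fin_num xm0 xmB)].
  congr (fine (_ - _)%E); apply: eq_esum => n _.
    by rewrite funeposE /= /xp EFin_max.
  by rewrite funenegE /= /xm EFin_max.
have -> : (fun N => \sum_(n <- modes N) x n) =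
    (fun N => \sum_(n <- modes N) xp n - \sum_(n <- modes N) xm n).
  apply/funext => N; rewrite -sumrB; apply: eq_bigr => n _.
  by rewrite /xp /xm !maxEle oppr_le0; case: (leP (x n) 0); case: (leP 0 (x n)) => ? ?; lra.
by apply: cvgB; [exact: (sum_modes_cvg xp0 xpB)|exact: (sum_modes_cvg xm0 xmB)].
Qed.

Definition rdot (z w : Rcomplex R) : R := complex.Re z * complex.Re w + complex.Im z * complex.Im w.

Lemma rdotE (z w : Rcomplex R) : complex.Re (z * (conjc w : Rcomplex R)) = rdot z w.
Proof. by case: z w => [a b] [a' b'] /=; rewrite /rdot /=; ring. Qed.

Lemma rdot_young (z w : Rcomplex R) (l : R) : 0 < l ->
  `|rdot z w| <= (l * `|z| ^+ 2 + l^-1 * `|w| ^+ 2) / 2.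
Proof.
move=> l0; rewrite !rnormc_sqr /rdot; case: z w => [a b] [a' b'] /=.
have k0 : 0 < l^-1 by rewrite invr_gt0.
have kl : l * l^-1 = 1 by rewrite mulfV // gt_eqF.
have H p q : `|p * q| <= (l * p ^+ 2 + l^-1 * q ^+ 2) / 2.
  have S1 : 0 <= l^-1 * (l * p - q) ^+ 2 by rewrite mulr_ge0 ?sqr_ge0 // ltW.
  have S2 : 0 <= l^-1 * (l * p + q) ^+ 2 by rewrite mulr_ge0 ?sqr_ge0 // ltW.
  have E1 : l^-1 * (l * p - q) ^+ 2 = (l * l^-1) * (l * p ^+ 2) - 2 * (l * l^-1) * (p * q) + l^-1 * q ^+ 2 by ring.
  have E2 : l^-1 * (l * p + q) ^+ 2 = (l * l^-1) * (l * p ^+ 2) + 2 * (l * l^-1) * (p * q) + l^-1 * q ^+ 2 by ring.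
  rewrite kl in E1 E2; rewrite ler_norml; apply/andP; split; lra.
by apply: le_trans (ler_normD _ _) _; have := H a a'; have := H b b'; lra.
Qed.

(** Cauchy-Schwarz from the weighted Young inequality; the weight |g| / |f| balances its two
    terms. *)
Lemma sum_rdot_le (f g : hscale (0 : R)) (r : seq nzint) : uniq r ->
  \sum_(n <- r) `|rdot (f n) (g n)| <= `|f| * `|g|.
Proof.
move=> ur.
have [f0|f0] := eqVneq f 0.
  rewrite f0 normr0 mul0r big1 // => n _.
  by rewrite /rdot /= !mul0r addr0 normr0.
have [g0|g0] := eqVneq g 0.
  rewrite g0 normr0 mulr0 big1 // => n _.
  by rewrite /rdot /= !mulr0 addr0 normr0.
have F0 : 0 < `|f| by rewrite normr_gt0.
have G0 : 0 < `|g| by rewrite normr_gt0.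
pose l := `|g| / `|f|; have l0 : 0 < l by rewrite divr_gt0.
apply: (@le_trans _ _ (\sum_(n <- r) (l / 2 * (hweight 0 n * `|f n| ^+ 2) + l^-1 / 2 * (hweight 0 n * `|g n| ^+ 2)))).
  apply: ler_sum => n _; apply: le_trans (rdot_young _ _ l0) _.
  by rewrite !hweight0; lra.
rewrite big_split /= -!big_distrr /=.
have H1 : l / 2 * \sum_(n <- r) (hweight 0 n * `|f n| ^+ 2) <= l / 2 * `|f| ^+ 2.
  by rewrite ler_wpM2l ?(hnorm_hbnd f ur) // ltW // divr_gt0.
have H2 : l^-1 / 2 * \sum_(n <- r) (hweight 0 n * `|g n| ^+ 2) <= l^-1 / 2 * `|g| ^+ 2.
  by rewrite ler_wpM2l ?(hnorm_hbnd g ur) // ltW // divr_gt0 // invr_gt0.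
apply: le_trans (lerD H1 H2) _; rewrite le_eqVlt; apply/orP; left; apply/eqP.
by rewrite /l; field; rewrite !gt_eqF.
Qed.

Lemma pairing_cvg (f g : hscale (0 : R)) :
  \sum_(n <- modes N) rdot (f n) (g n) @[N --> \oo] --> pairing f g.
Proof.
have -> : pairing f g = rsum (fun n => rdot (f n) (g n)).
  by congr rsum; apply/funext => n; exact: rdotE.
by apply: rsum_cvg => r ur; exact: sum_rdot_le.
Qed.

Lemma pairing_unique (f g : hscale (0 : R)) (l : R) :
  \sum_(n <- modes N) rdot (f n) (g n) @[N --> \oo] --> l -> pairing f g = l.
Proof. by apply: cvg_unique (@pairing_cvg f g); exact: Rhausdorff. Qed.

Lemma pairing_norm (f g : hscale (0 : R)) : `|pairing f g| <= `|f| * `|g|.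
Proof.
have C : `|\sum_(n <- modes N) rdot (f n) (g n)| @[N --> \oo] --> `|pairing f g|.
  by apply: cvg_norm; exact: pairing_cvg.
rewrite -(cvg_lim (@Rhausdorff R) C); apply: limr_le; first by apply/cvg_ex; eexists; exact: C.
apply: nearW => N; apply: le_trans (ler_norm_sum _ _ _) _.
exact: sum_rdot_le (modes_uniq N).
Qed.

Lemma rdotDr z w a (w' : Rcomplex R) : rdot z (a *: w + w') = a * rdot z w + rdot z w'.
Proof. by case: z w w' => [x y] [x' y'] [x'' y'']; rewrite /rdot /=; ring. Qed.

Lemma rdotC z w : rdot z w = rdot w z.
Proof. by rewrite /rdot; congr (_ + _); rewrite mulrC. Qed.

Lemma pairingC (f g : hscale (0 : R)) : pairing f g = pairing g f.
Proof.
apply: pairing_unique.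
have -> : (fun N => \sum_(n <- modes N) rdot (f n) (g n)) =
   (fun N => \sum_(n <- modes N) rdot (g n) (f n)).
  by apply/funext => N; apply: eq_bigr => n _; exact: rdotC.
exact: pairing_cvg.
Qed.

Lemma pairing_linear (f : hscale (0 : R)) : linear (fun g : hscale (0 : R) => pairing f g : R^o).
Proof.
move=> a g g'; apply: pairing_unique.
have -> : (fun N => \sum_(n <- modes N) rdot (f n) ((a *: g + g' : hscale (0 : R)) n)) =
   (fun N => a * \sum_(n <- modes N) rdot (f n) (g n) + \sum_(n <- modes N) rdot (f n) (g' n)).
  apply/funext => N; rewrite big_distrr -big_split /=; apply: eq_bigr => n _.
  exact: rdotDr.
by apply: cvgD (@pairing_cvg _ _); apply: cvgMr; exact: pairing_cvg.
Qed.

Lemma pairingDr (f g g' : hscale (0 : R)) : pairing f (g + g' : hscale (0 : R)) = pairing f g + pairing f g'.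
Proof. by have := pairing_linear f 1 g g'; rewrite !scale1r. Qed.

Lemma pairingZr a (f g : hscale (0 : R)) : pairing f (a *: g : hscale (0 : R)) = a * pairing f g.
Proof.
have := pairing_linear f a g 0; rewrite addr0 => ->.
have := pairing_linear f 1 0 0; rewrite scale1r addr0 -[1 *: _]/(1 * _) mul1r => /eqP.
by rewrite -subr_eq0 opprD addNKr oppr_eq0 => /eqP ->; rewrite addr0.
Qed.

Lemma pairingDl (f f' g : hscale (0 : R)) : pairing (f + f' : hscale (0 : R)) g = pairing f g + pairing f' g.
Proof. by rewrite pairingC pairingDr !(pairingC g). Qed.

Lemma pairingBl (f f' g : hscale (0 : R)) : pairing (f - f' : hscale (0 : R)) g = pairing f g - pairing f' g.
Proof.
rewrite pairingDl; congr (_ + _).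
by rewrite pairingC -scaleN1r pairingZr mulN1r pairingC.
Qed.

Lemma pairing_flowA d X t (f g : hscale (0 : R)) :
  pairing (flowA d X (- t) f) g = pairing f (flowA d X t g).
Proof.
apply: pairing_unique.
have -> : (fun N => \sum_(n <- modes N) rdot (flowA d X (- t) f n) (g n)) =
   (fun N => \sum_(n <- modes N) rdot (f n) (flowA d X t g n)).
  apply/funext => N; apply: eq_bigr => n _.
  rewrite -[flowA _ _ _ f n]/(cis _ * f n) -[flowA _ _ _ g n]/(cis _ * g n).
  rewrite mulNr /cis cosN sinN; move: (cos _) (sin _) => x y.
  by case: (f n) (g n) => [a b] [a' b']; rewrite /rdot /=; ring.
exact: pairing_cvg.
Qed.

Lemma is_gradientP (f : hscale (0 : R) -> R) (u g : hscale (0 : R)) :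
  (forall eps : R, 0 < eps -> exists2 delta : R, 0 < delta &
    forall w : hscale (0 : R), `|w| < delta ->
      `|f (u + w) - f u - pairing g w| <= eps * `|w|) -> is_gradient f u g.
Proof.
move=> H.
pose l := GRing.isLinear.Build R (hscale (0 : R)) R^o _ _ (pairing_linear g).
pose L : {linear hscale (0 : R) -> R^o} := HB.pack (fun w : hscale (0 : R) => pairing g w : R^o) l.
have Lc : continuous L.
  apply/linear_bounded_continuous/ex_bound; exists `|g|.
  apply/nbhs_ballP; exists 1 => //= w; rewrite -ball_normE /= sub0r normrN => /ltW w1.
  apply: le_trans (pairing_norm g w) _.
  by rewrite ler_piMr.
have Lo : (f : hscale (0 : R) -> R^o) \o shift u = cst (f u : R^o) + L +o_ (0 : hscale (0 : R)) id.
  apply/eqaddoP => eps eps0; have [dl d0 Hd] := H eps eps0.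
  apply/nbhs_ballP; exists dl => //= w; rewrite -ball_normE /= sub0r normrN => wd.
  by have := Hd w wd; rewrite (addrC u w) -addrA -opprD.
have E := diff_unique Lc Lo.
apply: DiffDef; last exact: E.
by apply/diff_locallyP; rewrite E.
Qed.

End Pairing.

(** * Riesz representation of functionals on H_{-h} in H_h *)

Section Dual.
Variable R : realType.

Definition restrict_coef (r : seq nzint) (f : nzint -> Rcomplex R) : nzint -> Rcomplex R :=
  fun n => if n \in r then f n else 0.

Lemma restrict_hbnd s r f :
  hbnd s (Num.sqrt (\sum_(n <- undup r) hweight s n * `|f n| ^+ 2)) (restrict_coef r f).
Proof.
have t0 n : 0 <= hweight s n * `|f n| ^+ 2 by rewrite mulr_ge0 ?hweight_ge0 ?sqr_ge0.
move=> q uq; rewrite sqr_sqrtr ?sumr_ge0 //.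
rewrite (bigID (mem r)) /= [X in _ + X]big1 ?addr0; last first.
  by move=> n /negbTE nr; rewrite /restrict_coef nr normr0 expr0n mulr0.
rewrite (eq_bigr (fun n => hweight s n * `|f n| ^+ 2)); last first.
  by move=> n nr; rewrite /restrict_coef nr.
rewrite [leRHS](bigID (mem q)) /= -big_filter -[X in _ <= X + _]big_filter.
have P : perm_eq [seq n <- q | n \in r] [seq n <- undup r | n \in q].
  apply: uniq_perm; rewrite ?filter_uniq ?undup_uniq // => n.
  by rewrite !mem_filter mem_undup andbC.
by rewrite (perm_big _ P) lerDl sumr_ge0.
Qed.

Definition finvec s r f : hscale s := HScale (hbnd_in (@restrict_hbnd s r f)).

Lemma finvec_norm s r f :
  `|finvec s r f| <= Num.sqrt (\sum_(n <- undup r) hweight s n * `|f n| ^+ 2).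
Proof. by apply: hnorm_le; [exact: sqrtr_ge0 | exact: restrict_hbnd]. Qed.

Definition single s n (z : Rcomplex R) : hscale s := finvec s [:: n] (fun=> z).

Lemma single_split s n z :
  single s n z = complex.Re z *: single s n 1 + complex.Im z *: single s n 'i%C.
Proof.
apply: hscale_ext => k; rewrite coefD !coefZ /= /restrict_coef; case: ifP => _.
  by case: z => x y; congr Complex => /=; rewrite ?mulr0 ?mulr1 ?addr0 ?add0r.
by rewrite !scaler0 addr0.
Qed.

Lemma finvec_cons s n r f : n \notin r ->
  finvec s (n :: r) f = single s n (f n) + finvec s r f.
Proof.
move=> nr; apply: hscale_ext => k; rewrite coefD /= /restrict_coef !inE.
by have [->|_] := eqVneq k n; rewrite ?(negbTE nr) ?addr0 ?add0r.
Qed.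

Lemma rnormcZ (a : R) (z : Rcomplex R) : `|a *: z| ^+ 2 = a ^+ 2 * `|z| ^+ 2.
Proof. by rewrite !rnormc_sqr; case: z => x y /=; ring. Qed.

Section Functional.
Variables (h K : R) (l : hscale (- h) -> R).
Hypothesis l_lin : forall a w w', l (a *: w + w') = a * l w + l w'.
Hypothesis K0 : 0 <= K.
Hypothesis l_bnd : forall w, `|l w| <= K * `|w|.

(* The Riesz representative of a functional on H_{-h}, an element of H_h. *)
Definition dual_coef (n : nzint) : Rcomplex R :=
  Complex (l (single (- h) n 1)) (l (single (- h) n 'i%C)).

Lemma functional0 : l 0 = 0.
Proof.
by have := l_lin 1 0 0; rewrite scale1r addr0 mul1r => /eqP; rewrite -subr_eq0 opprD addNKr oppr_eq0 => /eqP.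
Qed.

Lemma functionalD w w' : l (w + w') = l w + l w'.
Proof. by have := l_lin 1 w w'; rewrite scale1r mul1r. Qed.

Lemma functionalZ a w : l (a *: w) = a * l w.
Proof. by have := l_lin a w 0; rewrite !addr0 functional0 addr0. Qed.

Lemma functionalB w w' : l (w - w') = l w - l w'.
Proof. by rewrite functionalD -scaleN1r functionalZ mulN1r. Qed.

Lemma functional_single n z : l (single (- h) n z) = rdot (dual_coef n) z.
Proof.
rewrite single_split l_lin functionalZ /rdot /=.
by rewrite mulrC [X in _ + X]mulrC.
Qed.

Lemma functional_finvec r f : uniq r ->
  l (finvec (- h) r f) = \sum_(n <- r) rdot (dual_coef n) (f n).
Proof.
elim: r => [_|n r IH /= /andP[nr ur]].
  rewrite big_nil (_ : finvec _ _ _ = 0) ?functional0 //.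
  by apply: hscale_ext.
by rewrite finvec_cons // functionalD functional_single IH // big_cons.
Qed.

(** The test vector with coefficients |n|^(2h) [dual_coef l n] on [r] has [l]-value S and norm at
    most sqrt S in H_{-h}, so S <= K sqrt S. *)
Lemma dual_hbnd : hbnd h K dual_coef.
Proof.
move=> r ur; set S := \sum_(n <- r) _.
have t0 n : 0 <= hweight h n * `|dual_coef n| ^+ 2 by rewrite mulr_ge0 ?hweight_ge0 ?sqr_ge0.
have S0 : 0 <= S by exact: sumr_ge0.
pose w := finvec (- h) r (fun n => hweight h n *: dual_coef n).
have lw : l w = S.
  rewrite functional_finvec //; apply: eq_bigr => n _.
  by rewrite rnormc_sqr /rdot; case: (dual_coef n) => x y /=; ring.
have nw : `|w| <= Num.sqrt S.
  apply: le_trans (finvec_norm _ _ _) _; rewrite undup_id //.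
  rewrite ler_wsqrtr // le_eqVlt; apply/orP; left; apply/eqP; apply: eq_bigr => n _.
  rewrite rnormcZ mulrA; congr (_ * _); rewrite expr2 mulrA.
  rewrite (_ : hweight (- h) n * hweight h n = 1) ?mul1r //.
  rewrite /hweight mulrN powRN mulVf // gt_eqF // powR_gt0 //.
  exact: size_of_gt0.
have := le_trans (l_bnd w) (ler_wpM2l K0 nw); rewrite lw ger0_norm //.
have := sqr_sqrtr S0; have := sqrtr_ge0 S; move: (Num.sqrt S) => q q0 <- qK.
rewrite ler_pXn2r ?nnegrE // leNgt; apply/negP => Kq.
move: qK; apply/negP; rewrite -ltNge expr2 ltr_pM2r //; exact: le_lt_trans Kq.
Qed.

(** Since h > 0, the truncations of [w] converge to it in H_{-h}, and on them [l] is a finite sum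
    over modes. *)
Lemma dual_pairing (g w : hscale (0 : R)) (h0 : - h <= 0) : 0 < h ->
  g =1 dual_coef -> pairing g w = l (emb h0 w).
Proof.
move=> hp gE; apply: pairing_unique; apply/cvgrPdist_le => e e0.
have K1 : 0 < K + 1 by rewrite ltr_wpDl.
have d0 : 0 < e / (K + 1) by rewrite divr_gt0.
have hp' : - h < 0 by rewrite oppr_lt0.
have [N0 HN0] := hbnd_tail hp' (normr_ge0 w) d0.
exists N0 => // N /= NN.
rewrite (eq_bigr (fun n => rdot (dual_coef n) (w n))) => [|n _]; last by rewrite gE.
rewrite -functional_finvec ?modes_uniq // -functionalB.
apply: le_trans (l_bnd _) _.
suff H : `|emb h0 w - finvec (- h) (modes N) w| <= e / (K + 1).
  apply: le_trans (ler_wpM2l K0 H) _; rewrite mulrCA ger_pMr //.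
  by rewrite ler_pdivrMr // mul1r lerDl.
apply: hnorm_le (ltW d0) _ => r ur.
have E n : (emb h0 w - finvec (- h) (modes N) w : hscale (- h)) n = if n \in modes N then 0 else w n.
  by rewrite coefB embE /= /restrict_coef; case: ifP => _; rewrite ?subrr ?subr0.
rewrite (bigID (fun n => n \in modes N)) big1 ?add0r; last first.
  by move=> n /andP[_ nN]; rewrite E nN normr0 expr0n mulr0.
rewrite (eq_bigr (fun n => hweight (- h) n * `|w n| ^+ 2)) => [|n /andP[_ /negbTE nN]]; last by rewrite E nN.
rewrite -big_filter; rewrite [leLHS]add0r; apply: (HN0 w); [exact: hnorm_hbnd | exact: filter_uniq |].
move=> n; rewrite mem_filter => /andP[+ _]; apply: contra.
by rewrite !mem_modes => /leq_trans; apply.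
Qed.

End Functional.
End Dual.

Section DualDiff.
Variables (R : realType) (h K : R) (l l' : hscale (- h) -> R).
Hypothesis l_lin : forall a w w', l (a *: w + w') = a * l w + l w'.
Hypothesis l_lin' : forall a w w', l' (a *: w + w') = a * l' w + l' w'.
Hypothesis K0 : 0 <= K.
Hypothesis ll_bnd : forall w, `|l w - l' w| <= K * `|w|.

Lemma dual_diff_hbnd : hbnd h K (dual_coef l - dual_coef l').
Proof.
have L a w w' : l (a *: w + w') - l' (a *: w + w') = a * (l w - l' w) + (l w' - l' w').
  by rewrite l_lin l_lin'; ring.
exact: (dual_hbnd L K0 ll_bnd).
Qed.

End DualDiff.

(** * Calculus of iterated derivatives *)

Section IterDerivatives.
Variables (R : realType) (V : normedModType R) (f : V -> R) (D : V -> seq V -> R) (C : R).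
Hypothesis HD : iter_derivatives f D.
Hypothesis DC : forall u ws, (size ws <= 2)%N -> `|D u ws| <= C * \prod_(w <- ws) `|w|.

Lemma iterd1_linear u a w w' : D u [:: a *: w + w'] = a * D u [:: w] + D u [:: w'].
Proof. exact: (iterd_linear HD u [::] [::]). Qed.

Lemma iterd_head0 u ws : D u (0 :: ws) = 0.
Proof.
have := iterd_linear HD u [::] ws 1 0 0; rewrite scale1r addr0 mul1r /= => /eqP.
by rewrite -subr_eq0 opprD addNKr oppr_eq0 => /eqP.
Qed.

Lemma iterd_headZ u a w ws : D u (a *: w :: ws) = a * D u (w :: ws).
Proof. by have := iterd_linear HD u [::] ws a w 0; rewrite /= addr0 iterd_head0 addr0. Qed.

Lemma iterd_derive u w ws (s : R) :
  is_derive s 1 (fun r : R => D (u + r *: w) ws : R^o) (D (u + s *: w) (w :: ws)).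
Proof.
apply: is_derive1_eps => eps eps0.
pose P := \prod_(x <- ws) `|x|; have P0 : 0 <= P by exact: prodr_ge0.
pose K := `|w| * P + 1; have K0 : 0 < K by rewrite ltr_wpDl // mulr_ge0.
have e1 : 0 < eps / K by rewrite divr_gt0.
have /nbhs_ballP[dl /= d0 Hd] := iterdS HD (u + s *: w) (size ws) e1.
have W0 : 0 < `|w| + 1 by rewrite ltr_wpDl.
exists (dl / (`|w| + 1)); first by rewrite divr_gt0.
move=> r rs; have := Hd ((r - s) *: w) _ ws erefl.
rewrite -ball_normE /= sub0r normrN normrZ iterd_headZ -/P.
have -> : u + s *: w + (r - s) *: w = u + r *: w.
  by rewrite -addrA -scalerDl [s + _]addrC subrK.
move=> H; apply: le_trans (H _) _.
  rewrite ltr_pdivlMr // in rs; apply: le_lt_trans rs.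
  by rewrite ler_wpM2l // lerDl.
rewrite (_ : eps / K * _ * _ = eps * `|r - s| * (`|w| * P / K)); last by ring.
by rewrite ler_piMr ?mulr_ge0 ?(ltW eps0) // ler_pdivrMr // mul1r lerDl.
Qed.

Lemma iterd_mvt u w ws : exists2 c : R, 0 <= c <= 1 &
  D (u + w) ws - D u ws = D (u + c *: w) (w :: ws).
Proof.
have dphi (r : R) := iterd_derive u w ws r.
have [|c] := @MVT R (fun r => D (u + r *: w) ws) (fun r => D (u + r *: w) (w :: ws)) 0 1 ltr01
  (fun r _ => dphi r).
  apply: continuous_subspaceT => r; apply: differentiable_continuous.
  by apply/derivable1_diffP; case: (dphi r).
rewrite in_itv /= => /andP[c0 c1]; rewrite scale1r scale0r addr0 subr0 mulr1 => E.
by exists c => //; rewrite !ltW.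
Qed.

Lemma iterd1_norm u w : `|D u [:: w]| <= C * `|w|.
Proof. by have := DC u (ws := [:: w]) isT; rewrite big_seq1. Qed.

Lemma iterd1_lip u w x : `|D (u + w) [:: x] - D u [:: x]| <= C * `|w| * `|x|.
Proof.
have [c _ ->] := iterd_mvt u w [:: x].
by have := DC (u + c *: w) (ws := [:: w; x]) isT; rewrite big_cons big_seq1 mulrA.
Qed.

(** Two mean value steps along the segment, hence C rather than C / 2. *)
Lemma iterd_taylor u w : 0 <= C -> `|f (u + w) - f u - D u [:: w]| <= C * `|w| ^+ 2.
Proof.
move=> C0; have [c /andP[c0 c1]] := iterd_mvt u w [::].
rewrite !(iterd0 HD) => ->; apply: le_trans (iterd1_lip _ _ _) _.
rewrite normrZ ger0_norm // expr2 !mulrA ler_wpM2r //.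
by rewrite -!mulrA ler_wpM2l // ler_piMl.
Qed.

End IterDerivatives.

(** * Periodic solutions *)

Lemma continuous_eps (R : realType) (V : normedModType R) (f : R -> V) (t eps : R) :
  {for t, continuous f} -> 0 < eps ->
  exists2 delta : R, 0 < delta & forall s, `|s - t| < delta -> `|f s - f t| <= eps.
Proof.
move=> /cvgrPdist_le fc e0.
have /nbhs_ballP[dl /= d0 Hd] := fc eps e0.
by exists dl => // s st; rewrite distrC; apply: Hd; rewrite -ball_normE /= distrC.
Qed.

Lemma smooth_curve_continuous (R : realType) (V : normedModType R) (f : R -> V) :
  smooth_curve f -> continuous f.
Proof.
move=> fs t; apply: differentiable_continuous; apply/derivable1_diffP.
exact: (fs 0%N t).
Qed.

(** Supplies the uniform bound in H_h on the linear part [c]. *)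
Lemma periodic_continuous_bounded (R : realType) (V : normedModType R) (f : R -> V) (T : R) :
  0 < T -> continuous f -> (forall t, f (t + T) = f t) ->
  exists B, forall t, `|f t| <= B.
Proof.
move=> T0 fc fT.
have fTn n t : f (t + n%:R * T) = f t.
  elim: n => [|n IH]; first by rewrite mul0r addr0.
  by rewrite -natr1 mulrDl mul1r addrA fT.
have fTz (k : int) t : f (t + k%:~R * T) = f t.
  case: k => n; first exact: fTn.
  by rewrite NegzE mulrNz mulNr -(fTn n.+1 (t - _)) subrK.
have nc : continuous (fun t => `|f t|).
  by move=> t; apply: cvg_norm; exact: fc.
have [c _ Hc] := EVT_max (ltW T0) (continuous_subspaceT nc).
exists `|f c| => t.
have -> : f t = f (t + (- Num.floor (t / T))%:~R * T) by rewrite fTz.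
have /andP[k1 k2] := floor_itv (t / T).
rewrite intrD ler_pdivlMr // ltr_pdivrMr // in k1 k2.
apply: Hc; rewrite in_itv /= intrN mulNr; apply/andP; split; first by lra.
by move: k2; rewrite mulrDl mul1r; lra.
Qed.

Lemma near_ballP (R : realType) (t : R) (P : R -> Prop) :
  (\forall t' \near t, P t') <->
  exists2 delta : R, 0 < delta & forall t', `|t' - t| < delta -> P t'.
Proof.
split=> [/nbhs_ballP[dl /= d0 H]|[dl d0 H]].
  by exists dl => // t' tt; apply: H; rewrite -ball_normE /= distrC.
by apply/nbhs_ballP; exists dl => // t'; rewrite -ball_normE /= distrC; exact: H.
Qed.

(** * Strong continuity of the free flow *)

Section FlowContinuity.
Variable R : realType.

Lemma rmul_sub_split (a b x y : Rcomplex R) : a * x - b * y = a * (x - y) + (a - b) * y.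
Proof. by rewrite mulrBr mulrBl addrA subrK. Qed.

Lemma cis_near (a t eps : R) : 0 < eps ->
  \forall t' \near t, `|(cis (t' * a) - cis (t * a) : Rcomplex R)| <= eps.
Proof.
move=> e0; have e2 : 0 < eps / 2 by rewrite divr_gt0.
have cc : continuous (fun t : R => cos (t * a)).
  move=> x; apply: (@continuous_comp _ _ _ (fun t : R => t * a) (@cos R)); last exact: continuous_cos.
  exact: mulrr_continuous.
have sc : continuous (fun t : R => sin (t * a)).
  move=> x; apply: (@continuous_comp _ _ _ (fun t : R => t * a) (@sin R)); last exact: continuous_sin.
  exact: mulrr_continuous.
have /near_ballP c1 := continuous_eps (cc t) e2.
have /near_ballP s1 := continuous_eps (sc t) e2.
apply: filterS2 c1 s1 => t' ct st; apply: le_trans (rnormc_le _) _.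
by rewrite (splitr eps); apply: lerD.
Qed.

Lemma flowA_hbnd s B d X t (v : nzint -> Rcomplex R) :
  hbnd s B v -> hbnd s B (fun n => cis (t * eigenA d X n) * v n).
Proof.
move=> vB r ur; apply: le_trans (vB r ur); apply: ler_sum => n _.
rewrite rnormcM (_ : `|cis _| = 1) ?mul1r //.
by rewrite /Num.norm /= cos2Dsin2 sqrtr1.
Qed.

(** Each mode turns continuously, but the frequencies are unbounded; the bound in H_s disposes of
    the high modes. *)
Lemma flowA_near s B d X (v : hscale (0 : R)) t (eps : R) : 0 < s -> 0 <= B ->
  hbnd s B v -> 0 < eps ->
  \forall t' \near t, `|flowA d X t' v - flowA d X t v| <= eps.
Proof.
move=> s0 B0 vB e0.
apply: (@hbnd_cvg0 _ _ _ (nbhs_filter t) s (B + B) (fun t' => flowA d X t' v - flowA d X t v)) => //.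
  exact: addr_ge0.
  by apply: nearW => t'; apply: hbndB => //; exact: flowA_hbnd.
move=> n e' e'0; have v1 : 0 < `|v n| + 1 by rewrite ltr_wpDl.
have e1 : 0 < e' / (`|v n| + 1) by rewrite divr_gt0.
apply: filterS (cis_near (eigenA d X n) t e1) => t' H.
rewrite coefB -[flowA _ _ _ _ n]/(cis _ * v n) -[flowA _ _ t _ n]/(cis _ * v n).
rewrite -mulrBl rnormcM.
apply: (@le_trans _ _ (e' / (`|v n| + 1) * (`|v n| + 1))).
  by apply: ler_pM => //; rewrite lerDl.
by rewrite divfK // gt_eqF.
Qed.

End FlowContinuity.

(** * The gradient in the rotating frame *)

Section Gradient.
Variables (R : realType) (d : nat) (T X h : R) (F : R -> hscale (0 : R) -> R).
Variables (c : R -> hscale h) (Fe : R -> hscale (- h) -> R).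
Variables (D : R -> hscale (- h) -> seq (hscale (- h)) -> R) (C : R).
Hypotheses (T0 : 0 < T) (hp : 0 < h) (C0 : 0 <= C).
Hypothesis F_smooth : smooth_in_time F.
Hypothesis c_smooth : smooth_curve c.
Hypothesis c_per : forall t, c (t + T) = c t.
Hypothesis Fbar_per : forall t, Fbar F c (t + T) =1 Fbar F c t.
Hypothesis Fe_ext : forall t, extends_to (Fbar F c t) (Fe t).
Hypothesis HD : forall t, iter_derivatives (Fe t) (D t).
Hypothesis DC : forall t u ws, (size ws <= 2)%N -> `|D t u ws| <= C * \prod_(w <- ws) `|w|.

Let h0 : 0 <= h := ltW hp.
Fact opp_regularity_le0 : - h <= 0. Proof. by rewrite oppr_le0. Qed.
Let hN := opp_regularity_le0.

Definition dform t (u : hscale (0 : R)) (w : hscale (- h)) : R := D t (emb hN u) [:: w].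

Lemma dform_linear t u a w w' : dform t u (a *: w + w') = a * dform t u w + dform t u w'.
Proof. exact: iterd1_linear (HD t) _ _ _ _. Qed.

Lemma dform_norm t u w : `|dform t u w| <= C * `|w|.
Proof. exact: iterd1_norm (@DC t) _ _. Qed.

Lemma dform_lip t u u' w : `|dform t u w - dform t u' w| <= C * `|u - u'| * `|w|.
Proof.
have := iterd1_lip (HD t) (@DC t) (emb hN u') (emb hN (u - u')) w.
rewrite -(emb_add hN u' (u - u')) (addrC u') (subrK u' u) => H; apply: le_trans H _.
by rewrite ler_wpM2r // ler_wpM2l // emb_norm.
Qed.

Lemma Fe_emb t u : Fe t (emb hN u) = Fbar F c t u.
Proof. by apply: Fe_ext => n; rewrite embE. Qed.

Lemma pairing_emb (f : hscale h) (w : hscale (0 : R)) : pairing f w = pairing (emb h0 f) w.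
Proof. by congr (rsum _); apply/funext => n; rewrite embE. Qed.

(* Regularity in time is only known for the values of F on H; the uniform bound on
   the second derivatives transfers it to the first derivative. *)
Lemma dform_taylor t (u w : hscale (0 : R)) (sg : R) : 0 < sg ->
  `|(Fbar F c t (u + sg *: w) - Fbar F c t u) / sg - dform t u (emb hN w)| <=
    C * `|w| ^+ 2 * sg.
Proof.
move=> sg0; have := iterd_taylor (HD t) (@DC t) (emb hN u) (sg *: emb hN w) C0.
rewrite -emb_scale -emb_add !Fe_emb emb_scale (iterd_headZ (HD t)).
rewrite -[D t _ _]/(dform t u (emb hN w)) normrZ gtr0_norm // exprMn => H.
have N2 : `|emb hN w| ^+ 2 <= `|w| ^+ 2 by rewrite ler_pXn2r ?nnegrE // emb_norm.
rewrite -(ler_pM2r sg0) -[X in _ * X <= _](gtr0_norm sg0) -normrM mulrBl divfK ?gt_eqF //.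
rewrite [dform _ _ _ * _]mulrC; apply: le_trans H _.
rewrite (_ : C * `|w| ^+ 2 * sg * sg = C * (sg ^+ 2 * `|w| ^+ 2)); last by ring.
by rewrite ler_wpM2l // ler_wpM2l ?sqr_ge0.
Qed.

Lemma Fbar_continuous u t (eps : R) : 0 < eps -> exists2 delta : R, 0 < delta &
  forall t', `|t' - t| < delta -> `|Fbar F c t' u - Fbar F c t u| <= eps.
Proof.
move=> e0; have e2 : 0 < eps / 2 by rewrite divr_gt0.
have [d1 d10 H1] := continuous_eps (@smooth_curve_continuous _ _ _ (@F_smooth u) t) e2.
have u1 : 0 < `|u| + 1 by rewrite ltr_wpDl.
have e3 : 0 < eps / 2 / (`|u| + 1) by rewrite divr_gt0.
have [d2 d20 H2] := continuous_eps (@smooth_curve_continuous _ _ _ (@c_smooth) t) e3.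
exists (Num.min d1 d2); first by rewrite lt_min d10.
move=> t'; rewrite lt_min => /andP[t1 t2].
rewrite /Fbar !pairing_emb.
rewrite (_ : _ - _ = (F t' u - F t u) - pairing (emb h0 (c t' - c t)) u); last first.
  by rewrite emb_sub pairingBl; ring.
apply: le_trans (ler_normB _ _) _; rewrite (splitr eps); apply: lerD; first exact: H1.
apply: le_trans (pairing_norm _ _) _.
apply: (@le_trans _ _ (eps / 2 / (`|u| + 1) * (`|u| + 1))).
  by apply: ler_pM => //; [exact: le_trans (emb_norm _ _) (H2 _ t2)|rewrite lerDl].
by rewrite divfK // gt_eqF.
Qed.

Lemma dform_continuous u w t (eps : R) : 0 < eps -> exists2 delta : R, 0 < delta &
  forall t', `|t' - t| < delta -> `|dform t' u (emb hN w) - dform t u (emb hN w)| <= eps.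
Proof.
move=> e0; pose K := C * `|w| ^+ 2 + 1.
have K0 : 0 < K by rewrite ltr_wpDl // mulr_ge0 // sqr_ge0.
(* This step makes the Taylor error at most eps / 4 at either time, which leaves eps / 2 for the
   change of the difference quotient. *)
pose sg := eps / 4 / K; have sg0 : 0 < sg by rewrite !divr_gt0.
have small : C * `|w| ^+ 2 * sg <= eps / 4.
  by rewrite /sg mulrCA ger_pMr ?divr_gt0 // ler_pdivrMr // mul1r lerDl.
have e1 : 0 < sg * (eps / 4) by rewrite mulr_gt0 // divr_gt0.
have [d1 d10 H1] := Fbar_continuous (u + sg *: w) t e1.
have [d2 d20 H2] := Fbar_continuous u t e1.
exists (Num.min d1 d2); first by rewrite lt_min d10.
move=> t'; rewrite lt_min => /andP[/H1 h1 /H2 h2].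
have A1 := le_trans (dform_taylor t u w sg0) small.
have A2 := le_trans (dform_taylor t' u w sg0) small.
have A3 : `|(Fbar F c t' (u + sg *: w) - Fbar F c t' u) / sg -
    (Fbar F c t (u + sg *: w) - Fbar F c t u) / sg| <= eps / 2.
  rewrite -mulrBl normrM normfV (gtr0_norm sg0) ler_pdivrMr //.
  rewrite (_ : _ - _ - (_ - _) = (Fbar F c t' (u + sg *: w) - Fbar F c t (u + sg *: w)) -
    (Fbar F c t' u - Fbar F c t u)); last by ring.
  apply: le_trans (ler_normB _ _) _; apply: le_trans (lerD h1 h2) _.
  by rewrite le_eqVlt; apply/orP; left; apply/eqP; field.
move: A1 A2 A3; rewrite !ler_norml => /andP[? ?] /andP[? ?] /andP[? ?].
by apply/andP; split; lra.
Qed.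

(** Periodicity is given for [Fbar] on H, not for the chosen extensions and derivatives, so
    difference quotients are compared as their step tends to 0. *)
Lemma dform_shift u w t : dform (t + T) u (emb hN w) = dform t u (emb hN w).
Proof.
apply/eqP; rewrite -subr_eq0 -normr_le0.
apply: (@le_of_small _ _ _ (2 * (C * `|w| ^+ 2)) 1) => //.
  by rewrite mulr_ge0 // mulr_ge0 // sqr_ge0.
move=> sg sg0 _; rewrite add0r.
have A1 := dform_taylor t u w sg0.
have A2 := dform_taylor (t + T) u w sg0; rewrite !Fbar_per in A2.
move: A1 A2; rewrite !ler_norml => /andP[? ?] /andP[? ?].
by apply/andP; split; lra.
Qed.

Definition gbar t u : hscale h := HScale (hbnd_in (dual_hbnd (dform_linear t u) C0 (dform_norm t u))).

Lemma gbar_norm t u : `|gbar t u| <= C.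
Proof. by apply: hnorm_le => //; exact: (dual_hbnd (dform_linear t u) C0 (dform_norm t u)). Qed.

Lemma gbar_lip t u u' : `|gbar t u - gbar t u'| <= C * `|u - u'|.
Proof.
apply: hnorm_le; first exact: mulr_ge0.
apply: (dual_diff_hbnd (dform_linear t u) (dform_linear t u')); first exact: mulr_ge0.
exact: dform_lip.
Qed.

Lemma single_emb n z : single (- h) n z = emb hN (single (0 : R) n z).
Proof. by apply: hscale_ext => k; rewrite embE. Qed.

Lemma gbar_shift t u : gbar (t + T) u = gbar t u.
Proof.
by apply: hscale_ext => n; rewrite /= /dual_coef !single_emb !dform_shift.
Qed.

Lemma gbar_continuous u t n (eps : R) : 0 < eps -> exists2 delta : R, 0 < delta &
  forall t', `|t' - t| < delta -> `|gbar t' u n - gbar t u n| <= eps.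
Proof.
move=> e0; have e2 : 0 < eps / 2 by rewrite divr_gt0.
have [d1 d10 H1] := dform_continuous u (single (0 : R) n 1) t e2.
have [d2 d20 H2] := dform_continuous u (single (0 : R) n 'i%C) t e2.
exists (Num.min d1 d2); first by rewrite lt_min d10.
move=> t'; rewrite lt_min => /andP[/H1 h1 /H2 h2].
apply: le_trans (rnormc_le _) _; rewrite (splitr eps); apply: lerD.
  by rewrite /= /dual_coef !single_emb.
by rewrite /= /dual_coef !single_emb.
Qed.

(* The gradient of G_t = F_t \o flowA t. *)
Definition vgrad t v : hscale h := flowA d X (- t) (gbar t (flowA d X t v) + c t).

Lemma vgrad_lip t v w : `|vgrad t v - vgrad t w| <= C * `|v - w|.
Proof.
rewrite (_ : vgrad t v - vgrad t w =
  flowA d X (- t) (gbar t (flowA d X t v) - gbar t (flowA d X t w))).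
  rewrite flowA_norm.
  by apply: le_trans (gbar_lip _ _ _) _; rewrite -flowA_sub flowA_norm.
by apply: hscale_ext => n; rewrite -[RHS]/(_ * (_ - _)) -[LHS]/(_ * (_ + _) - _ * (_ + _)); ring.
Qed.

Lemma vgrad_norm B : (forall t, `|c t| <= B) -> forall t v, `|vgrad t v| <= C + B.
Proof.
move=> cB t v; rewrite flowA_norm; apply: le_trans (ler_normD _ _) _.
by apply: lerD => //; exact: gbar_norm.
Qed.

Lemma vgrad_shift t v : vgrad (t + T) v = flowA d X (- T) (vgrad t (flowA d X T v)).
Proof.
by rewrite /vgrad c_per gbar_shift -!flowAD opprD [- t - T]addrC.
Qed.

(** The adjoint of the flow is its inverse, which carries the gradient of F_t back to the rotating
    frame. The remainder C |w|^2 dictates the radius eps / (C + 1). *)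
Lemma vgrad_gradient t v : is_gradient (F t \o flowA d X t) v (emb h0 (vgrad t v)).
Proof.
apply: is_gradientP => eps e0; have C1 : 0 < C + 1 by rewrite ltr_wpDl.
exists (eps / (C + 1)); first exact: divr_gt0.
move=> w wd.
change (`|F t (flowA d X t (v + w)) - F t (flowA d X t v) -
  pairing (emb h0 (vgrad t v)) w| <= eps * `|w|).
rewrite flowA_add /vgrad emb_flowA pairing_flowA.
set u := flowA d X t v; set z := flowA d X t w.
have zw : `|z| = `|w| by exact: flowA_norm.
have FE y : F t y = Fe t (emb hN y) + pairing (emb h0 (c t)) y.
  by rewrite Fe_emb /Fbar -pairing_emb subrK.
rewrite emb_add pairingDl.
rewrite (_ : pairing (emb h0 (gbar t u)) z = dform t u (emb hN z)); last first.
  apply: (dual_pairing (dform_linear t u) C0 (dform_norm t u)) => // n.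
  by rewrite embE.
rewrite !FE emb_add pairingDr.
have := iterd_taylor (HD t) (@DC t) (emb hN u) (emb hN z) C0.
rewrite -[D t _ _]/(dform t u (emb hN z)) => H.
rewrite (_ : _ - _ = Fe t (emb hN u + emb hN z) - Fe t (emb hN u) - dform t u (emb hN z)); last by ring.
apply: le_trans H _; rewrite expr2 mulrA; apply: ler_pM => //.
- by rewrite mulr_ge0.
- apply: le_trans (ler_wpM2l C0 (emb_norm _ _)) _; rewrite zw.
  rewrite ltr_pdivlMr // mulrC in wd; apply: le_trans (ltW wd).
  by rewrite ler_wpM2r // lerDl.
- by rewrite -zw emb_norm.
Qed.

(** The gradients stay bounded in H_h with h > 0, so continuity of each coefficient suffices. Four
    changes cost e / 4 each: the phase, the state moved by the flow, the time in [gbar], and [c]. *)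
Lemma vgrad_continuous s B t (v : hscale (0 : R)) : 0 < s -> 0 <= B -> hbnd s B v ->
  (exists B', forall t, `|c t| <= B') ->
  forall eps : R, 0 < eps -> exists2 delta : R, 0 < delta & forall t', `|t' - t| < delta ->
    `|emb h0 (vgrad t' v - vgrad t v)| <= eps.
Proof.
move=> s0 B0 vB [B' cB] eps e0; apply/near_ballP.
have B'0 : 0 <= B' by apply: le_trans (cB 0); exact: normr_ge0.
have CB0 : 0 <= C + B' by rewrite addr_ge0.
apply: (@hbnd_cvg0 _ _ _ (nbhs_filter t) h ((C + B') + (C + B'))
  (fun t' => emb h0 (vgrad t' v - vgrad t v))) => //; first exact: addr_ge0.
  apply: nearW => t' r ur.
  rewrite (eq_bigr (fun n => hweight h n * `|(vgrad t' v - vgrad t v : hscale h) n| ^+ 2)); last first.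
    by move=> n _; rewrite embE.
  apply: (hbndB (s := h) CB0 CB0) ur.
    exact: hbndW (vgrad_norm cB t' v) (hnorm_hbnd _).
  exact: hbndW (vgrad_norm cB t v) (hnorm_hbnd _).
move=> n e e1; pose u0 := flowA d X t v; pose Y t' : hscale h := gbar t' (flowA d X t' v) + c t'.
have e8 : 0 < e / 4 by rewrite divr_gt0.
have C1 : 0 < C + 1 by rewrite ltr_wpDl.
have coef_h (w : hscale h) : `|w n| <= `|w|.
  by have := coef_le (emb h0 w) n; rewrite embE => /le_trans; apply; exact: emb_norm.
have /near_ballP n1 := @gbar_continuous u0 t n _ e8.
have n2 := flowA_near d X t s0 B0 vB (divr_gt0 e8 C1).
have /near_ballP n3 := continuous_eps (@smooth_curve_continuous _ _ _ (@c_smooth) t) e8.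
have Y1 : 0 < `|Y t n| + 1 by rewrite ltr_wpDl.
have n4 := cis_near (- eigenA d X n) t (divr_gt0 e8 Y1).
apply: filterS2 (filterI n1 n2) (filterI n3 n4) => t' [h1 h2] [h3 h4].
rewrite embE coefB -[vgrad t' v n]/(cis (- t' * _) * Y t' n) -[vgrad t v n]/(cis (- t * _) * Y t n).
have E x : - x * eigenA d X n = x * - eigenA d X n by rewrite mulNr mulrN.
rewrite !E {E}.
rewrite rmul_sub_split.
apply: le_trans (ler_normD _ _) _; rewrite !rnormcM.
rewrite (_ : `|cis _| = 1) ?mul1r; last by rewrite /Num.norm /= cos2Dsin2 sqrtr1.
have T2 : `|(cis (t' * - eigenA d X n) - cis (t * - eigenA d X n) : Rcomplex R)| * `|Y t n| <= e / 4.
  apply: (@le_trans _ _ (e / 4 / (`|Y t n| + 1) * (`|Y t n| + 1))).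
    by apply: ler_pM => //; rewrite lerDl.
  by rewrite divfK // gt_eqF.
have T1 : `|(Y t' n - Y t n : Rcomplex R)| <= e / 4 + e / 4 + e / 4.
  rewrite (_ : Y t' n - Y t n = (gbar t' (flowA d X t' v) - gbar t' u0 : hscale h) n +
    (gbar t' u0 n - gbar t u0 n) + (c t' - c t : hscale h) n); last first.
    by rewrite /Y !coefB !coefD; ring.
  apply: le_trans (ler_normD _ _) _; apply: lerD; last exact: le_trans (coef_h _) h3.
  apply: le_trans (ler_normD _ _) _; apply: lerD => //.
  apply: le_trans (coef_h _) _; apply: le_trans (gbar_lip _ _ _) _.
  apply: le_trans (ler_wpM2l C0 h2) _.
  by rewrite mulrCA ger_pMr // ler_pdivrMr // mul1r lerDl.
by apply: le_trans (lerD T1 T2) _; lra.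
Qed.

End Gradient.

Theorem theorem9p2 (R : realType) (d : nat) (T X h : R)
    (F : R -> hscale (0 : R) -> R) :
  weakly_admissible d T X h F ->
  exists (u : R -> hscale (0 : R))
         (u' : R -> hscale (h - d%:R * (irr_measure (rotnum d T X) - 1) - 2^-1)),
    [/\ forall t, u t =1 u' t, weak_solution d X F u &
        forall t, u (t + T) = u t].
Proof.
move=> [d0 [T0 X0 dio] hdr Fs [c [cs cT FbT [Fe [Fext Fsm Fbd]]]]].
set r := irr_measure _ in hdr *.
have dR1 : 1 <= d%:R :> R by rewrite ler1n.
have dR0 : 0 < d%:R :> R by rewrite ltr0n.
(* This tolerance times d is 1/2, the loss allowed in the stated regularity. *)
have e0 : 0 < (2 * d%:R)^-1 :> R by rewrite invr_gt0 mulr_gt0.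
have [rho irr rho_lt] := irr_measure_approx dio e0.
have rho0 := irr_exponents_ge0 irr.
have drho : d%:R * rho < d%:R * r + 2^-1.
  have := rho_lt; rewrite -(ltr_pM2l dR0) mulrDr invfM mulrCA mulfV ?gt_eqF // mulr1.
  exact.
have [Cm [m [mC minv]]] := small_divisor_mult h irr.
set s := h - d%:R * (rho - 1) in mC.
(* In fact s > d - 1/2, from h > d r and d rho < d r + 1/2. *)
have s0 : 0 < s by rewrite /s mulrBr mulr1; lra.
have r0 : 0 <= r.
  by apply: lb_le_inf; [case: dio | move=> x; exact: irr_exponents_ge0].
have hp : 0 < h by apply: le_lt_trans hdr; rewrite mulr_ge0 // ltW.
have [D HD] := choice Fsm.
have [C0 HC0] := Fbd 2%N.
pose C := `|C0|.
have CC : 0 <= C by exact: normr_ge0.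
have DC t u ws : (size ws <= 2)%N -> `|D t u ws| <= C * \prod_(w <- ws) `|w|.
  move=> sz; apply: le_trans (HC0 t (D t) (HD t) u ws sz) _.
  by rewrite ler_wpM2r ?ler_norm // prodr_ge0.
have [B cB] := periodic_continuous_bounded T0 (@smooth_curve_continuous _ _ _ cs) cT.
have B0 : 0 <= B by apply: le_trans (cB 0); exact: normr_ge0.
have CB0 : 0 <= C + B by rewrite addr_ge0.
have [v [vB vT vD]] := periodic_solution (g := vgrad d X c hp CC HD DC) (h0 := ltW hp)
  T0 s0 CB0 CC (vgrad_norm d X hp CC HD DC cB) (vgrad_lip d X c hp CC HD DC)
  (fun t b v b0 vb => vgrad_continuous d X hp CC Fs cs Fext HD DC t s0 b0 vb (ex_intro _ B cB))
  (vgrad_shift d X hp CC cT FbT Fext HD DC) mC minv.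
have Bv0 : 0 <= Cm * (T * (C + B)).
  by rewrite mulr_ge0 //; [case: mC | rewrite mulr_ge0 // ltW].
have ss : h - d%:R * (r - 1) - 2^-1 <= s by rewrite /s !mulrBr; lra.
have uB t : hbnd (h - d%:R * (r - 1) - 2^-1) (Cm * (T * (C + B))) (flowA d X t (v t)).
  move=> q uq; apply: le_trans (flowA_hbnd d X t (vB t) uq).
  by apply: ler_sum => n _; rewrite ler_wpM2r ?sqr_ge0 // le_hweight.
exists (fun t => flowA d X t (v t)), (fun t => HScale (hbnd_in (uB t))); split=> //.
  exists v => // t; exists (emb (ltW hp) (vgrad d X c hp CC HD DC t (v t))).
    exact: (vgrad_gradient d X hp CC Fext HD DC).
  exact: vD.
by move=> t; rewrite vT -flowAD addrK.
Qed.
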